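(* Let $D_1, D_2 \subset \mathbb{R}^2$ be compact domains and let $f : D_1 \to D_2$ be an orientation preserving diffeomorphism. Then $f$ can be realized by 6 reflections from a finite collection of mirrors in $\mathbb{R}^3$.
   Context: Orthonormal coordinates in $\mathbb{R}^{3}$ are $(x,z)$ with $x = (x_1,x_2) \in \mathbb{R}^2$, $z \in \mathbb{R}$. A compact domain is the closure of a bounded domain; smoothness of maps on it is understood up to the boundary. Orientation preserving means that the Jacobian determinant of $f$ is positive. Mirrors are pieces (subsets) of smooth surfaces in $\mathbb{R}^{3}$. A light ray (billiard particle) moves with unit speed along straight lines in the complement of the mirrors, and when it hits a mirror at a point with normal vector $\nu$, its velocity $v$ is replaced by $v - 2\langle v, \nu\rangle \nu/|\nu|^2$. A diffeomorphism $f : D_1 \to D_2$ is realized by $k$ reflections from a finite collection of mirrors if for every $x \in D_1$ the particle whose position at all sufficiently small (very negative) times $t$ is $(x,t)$ (so it moves in the direction of the $z$-axis) makes exactly $k$ reflections off the mirrors, has no other points in common with the mirrors, and after the last reflection moves again in the direction of the $z$-axis, having position $(f(x), t - \tau(x))$ for all sufficiently large $t$, for some number $\tau(x)$. *)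

(* Defs.v *)
From HB Require Import structures.
From mathcomp Require Import all_boot all_order all_algebra.
From mathcomp Require Import all_classical all_reals all_analysis.

Set Implicit Arguments.
Unset Strict Implicit.
Unset Printing Implicit Defensive.

Import Order.TTheory GRing.Theory Num.Theory.
Import numFieldNormedType.Exports.

Local Open Scope classical_set_scope.
Local Open Scope ring_scope.

(* C^oo on an open set U: all iterated directional derivatives of f exist and
   are (Frechet) differentiable on U. *)
Definition smooth_on (R : realType) (V W : normedModType R)
    (U : set V) (f : V -> W) : Prop :=
  forall (vs : seq V) (x : V), U x ->
    differentiable (foldr (fun v g => 'D_v g) f vs) x.

(* Smoothness up to the boundary on an arbitrary set D: f coincides on D with a
   C^oo map defined on an open neighbourhood of D.  The values of f outside D
   are irrelevant. *)
Definition smooth_upto (R : realType) (V W : normedModType R)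
    (D : set V) (f : V -> W) : Prop :=
  exists (U : set V) (F : V -> W),
    [/\ open U, D `<=` U, smooth_on U F & forall x, D x -> f x = F x].

Definition domain (R : realType) (V : normedModType R) (W : set V) : Prop :=
  [/\ open W, connected W & W !=set0].

Definition compact_domain (R : realType) (V : normedModType R)
    (D : set V) : Prop :=
  exists W : set V, [/\ domain W, bounded_set W & D = closure W].

Definition diffeomorphism (R : realType) (V W : normedModType R)
    (D1 : set V) (D2 : set W) (f : V -> W) : Prop :=
  [/\ set_bij D1 D2 f, smooth_upto D1 f &
      exists g : W -> V,
        smooth_upto D2 g /\ (forall x, D1 x -> g (f x) = x)].

(* Positivity is only asked in the interior, where f determines its Jacobian
   whatever its values outside D.  For a diffeomorphism of compact domains it
   extends to the boundary: the Jacobian of a smooth extension is continuous,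
   nonsingular on D, and the interior is dense in D. *)
Definition orientation_preserving (R : realType) (n : nat)
    (D : set 'rV[R]_n) (f : 'rV[R]_n -> 'rV[R]_n) : Prop :=
  forall x, (interior D) x -> 0 < \det ('J f x).

(* Euclidean inner product; the library norm on row vectors is the sup norm. *)
Definition dot (R : realType) (n : nat) (u v : 'rV[R]_n) : R :=
  \sum_(i < n) u 0 i * v 0 i.

Definition point3 (R : realType) (x : 'rV[R]_2) (z : R) : 'rV[R]_3 :=
  row_mx x (const_mx z : 'rV[R]_1).

(* Embedded, not necessarily closed, surface without boundary: locally a
   regular level set. *)
Definition smooth_surface (R : realType) (S : set 'rV[R]_3) : Prop :=
  forall p, S p -> exists (U : set 'rV[R]_3) (g : 'rV[R]_3 -> R),
    [/\ open U, U p, smooth_on U g,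
        forall q, U q -> (S q <-> g q = 0) &
        exists w, 'D_w g p != 0].

Definition tangent_vector (R : realType) (S : set 'rV[R]_3)
    (p w : 'rV[R]_3) : Prop :=
  exists c : R -> 'rV[R]_3,
    [/\ c 0 = p, \forall s \near 0, S (c s) & is_derive (0 : R) (1 : R) c w].

Definition normal_vector (R : realType) (S : set 'rV[R]_3)
    (p nu : 'rV[R]_3) : Prop :=
  nu != 0 /\ forall w, tangent_vector S p w -> dot nu w = 0.

(* The piece [mirror_set] may be any subset of the surface; the surface is kept
   because it determines the normals at the points of the piece. *)
Record mirror (R : realType) := Mirror {
  mirror_surface : set 'rV[R]_3;
  mirror_set : set 'rV[R]_3;
  mirror_surface_smooth : smooth_surface mirror_surface;
  mirror_set_sub : mirror_set `<=` mirror_surface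
}.

Definition reflect_velocity (R : realType) (nu v : 'rV[R]_3) : 'rV[R]_3 :=
  v - (2 * dot v nu / dot nu nu) *: nu.

(* The closed time interval between the reflections i-1 and i (unbounded for
   i = 0 and for i = k), t being the increasing sequence of reflection times. *)
Definition leg (R : realType) (k : nat) (t : 'I_k -> R) (i : nat) : set R :=
  [set s | (forall j : 'I_k, (j < i)%N -> t j <= s) /\
           (forall j : 'I_k, (i <= j)%N -> s <= t j)].

(* gam : R -> R^3 is the complete motion of a particle which makes exactly the
   k reflections at times t and has velocity v i on the i-th leg.  A reflection
   is a transversal impact; at a point lying on several mirrors the reflection
   law must hold with respect to each of them.  Consecutive closed legs overlap
   at a reflection time, so gam is continuous. *)
Definition billiard_motion (R : realType) (N : nat) (M : 'I_N -> mirror R)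
    (k : nat) (t : 'I_k -> R) (v : nat -> 'rV[R]_3)
    (gam : R -> 'rV[R]_3) : Prop :=
  [/\ forall i j : 'I_k, (i < j)%N -> t i < t j,
      forall i, (i <= k)%N -> dot (v i) (v i) = 1,
      forall i, (i <= k)%N -> forall s s', leg t i s -> leg t i s' ->
        gam s' = gam s + (s' - s) *: v i,
      forall s, (exists m, mirror_set (M m) (gam s)) <-> (exists j, s = t j) &
      forall (j : 'I_k) (m : 'I_N), mirror_set (M m) (gam (t j)) ->
        exists nu, [/\ normal_vector (mirror_surface (M m)) (gam (t j)) nu,
          dot (v j) nu != 0 & v j.+1 = reflect_velocity nu (v j)]].

Definition realized_by (R : realType) (N : nat) (M : 'I_N -> mirror R)
    (k : nat) (D : set 'rV[R]_2) (f : 'rV[R]_2 -> 'rV[R]_2) : Prop :=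
  forall x, D x ->
    exists (t : 'I_k -> R) (v : nat -> 'rV[R]_3) (gam : R -> 'rV[R]_3),
      [/\ billiard_motion M t v gam,
          \forall s \near -oo%R, gam s = point3 x s &
          exists tau : R, \forall s \near +oo%R, gam s = point3 (f x) (s - tau)].

(* Main.v *)
(* If dS = (q - p) . dp on a plane domain, a vertical beam at p that is
   reflected by the graph of a suitable multiple of S over p, and then by a
   similar graph over q, becomes the vertical beam at q: two mirrors (a
   periscope) realize x |-> q whenever q . dp is exact, that is, whenever
   p |-> q is a gradient map.  Horizontal translations are gradient maps too.

   A map F = (u, v) with positive Jacobian is locally a composition of three
   gradient maps x -> p -> q -> y: integrating v along x_1 gives H with H_1 = v,
   and p = grad H = (H_0, v), where a term lam x_0^2 / 2 makes the Jacobian of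
   p negative; then du/dp_0 < 0, and integrating u - p_0 along p_0 gives K with
   K_0 = u - p_0 and q = grad K a local diffeomorphism; finally
   q_0 = u - p_0 and p_1 = v make y . dq exact.

   The mirrors need not be connected, so D1 may be cut into finitely many
   pieces on which f factors in this way.  Each piece gets its own three
   periscopes; translating the intermediate beams far apart horizontally, and
   using a separate range of heights for each periscope, prevents unwanted
   hits. *)

(* The obstacle is unwanted hits, above all of a diagonal leg on the two mirrors that it joins. Let
   a periscope include a horizontal translation by [s], and divide its heights by [c = |s|]. In the
   direction of the leg the mirrors then have slope about 1, so they climb by about [c] over the
   extent of the leg, whereas the leg itself climbs by an amount bounded independently of [c]. For
   [c] large compared with the local bounds, the leg can meet a mirror only at an endpoint. The same
   normalization keeps every mirror in a slab whose thickness does not depend on the translation.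
   All this needs one constant [C] that bounds positions, heights and Lipschitz constants on all
   pieces before any distance is fixed.

   The two heights of a periscope can be raised together but not separately: their difference is the
   rise of the leg, which the reflection law fixes. They therefore share a slab, and only vertical
   segments lead from one slab to another. *)
From HB Require Import structures.
Require Import Defs.
From mathcomp Require Import all_boot all_order all_algebra.
From mathcomp Require Import all_classical all_reals all_analysis.
From mathcomp Require Import ring lra zify.

Set Implicit Arguments.
Unset Strict Implicit.
Unset Printing Implicit Defensive.

Import Order.TTheory GRing.Theory Num.Theory.
Import numFieldNormedType.Exports.

Local Open Scope classical_set_scope.
Local Open Scope ring_scope.

(** * Iterated differentiability *)

Section Estimates.
Context {R : realType} {V W : normedModType R}.

Lemma differentiable_estimate (f : V -> W) (x : V) : differentiable f x ->
  forall e, 0 < e ->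
  \forall h \near (0 : V), `|f (h + x) - f x - 'd f x h| <= e * `|h|.
Proof.
move=> /diff_locallyP[_ /eqaddoP H] e e0.
apply: filterS (H e e0) => h /=.
by rewrite !fctE /= opprD addrA.
Qed.

Lemma estimate_differentiable (f : V -> W) (L : {linear V -> W}) (x : V) :
  continuous L ->
  (forall e, 0 < e ->
    \forall h \near (0 : V), `|f (h + x) - f x - L h| <= e * `|h|) ->
  differentiable f x /\ 'd f x = L :> (V -> W).
Proof.
move=> cL H.
have E : f \o shift x = cst (f x) + L +o_ (0 : V) id.
  apply/eqaddoP => e e0; apply: filterS (H e e0) => h /=.
  by rewrite !fctE /= opprD addrA.
have dL := diff_unique cL E.
by split=> //; apply/diff_locallyP; rewrite dL.
Qed.

Lemma near_eq_differentiable (f g : V -> W) (x : V) :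
  (\forall y \near x, f y = g y) -> differentiable f x -> differentiable g x.
Proof.
move=> fg df.
have cL : continuous ('d f x) by case/diff_locallyP: df.
have fgx : f x = g x by exact: nbhs_singleton fg.
suff [] : differentiable g x /\ 'd g x = 'd f x :> (V -> W) by [].
apply: estimate_differentiable => // e e0.
have : \forall h \near (0 : V), f (h + x) = g (h + x).
  by move: fg; rewrite (near_shift 0) /= subr0.
apply: filterS2 (differentiable_estimate df e0) => h + fgh.
by rewrite -fgh -fgx.
Qed.

End Estimates.

Section Diffn.
Context {R : realType} {V : normedModType R}.
Implicit Types (f g : V -> R) (U : set V).

(** The product and chain rules turn one derivative into sums of products; an induction on the order
    [k] can handle these, an induction on the list of directions cannot. Order [0] already asks for
    one derivative. *)
Fixpoint diffn k U f : Prop :=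
  (forall x, U x -> differentiable f x) /\
  (if k is k'.+1 then forall v, diffn k' U ('D_v f) else True).

Lemma diffn_diff k U f x : diffn k U f -> U x -> differentiable f x.
Proof. by case: k => [|k] [+ _]; apply. Qed.

Lemma diffnS_le k U f : diffn k.+1 U f -> diffn k U f.
Proof.
elim: k f => [|k IH] f [df Hf]; first by split.
by split=> // v; apply: IH; exact: Hf.
Qed.

Lemma diffn_eq k U f g : open U -> (forall x, U x -> f x = g x) ->
  diffn k U f -> diffn k U g.
Proof.
move=> oU; elim: k f g => [|k IH] f g fg [df Hf].
all: have nfg x : U x -> \forall y \near x, f y = g y
  by move=> Ux; apply: filterS (open_nbhs_nbhs (conj oU Ux)) => y; exact: fg.
  by split=> // x Ux; exact: near_eq_differentiable (nfg _ Ux) (df _ Ux).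
split=> [x Ux|v]; first exact: near_eq_differentiable (nfg _ Ux) (df _ Ux).
by apply: IH (Hf v) => x Ux; exact: near_eq_derive (nfg _ Ux).
Qed.

Lemma diffn_cst k U (c : R) : diffn k U (cst c).
Proof.
elim: k c => [|k IH] c; split=> // v.
have -> : 'D_v (cst c) = cst 0 :> (V -> R).
  by apply/funext => x; rewrite derive_cst.
exact: IH.
Qed.

Lemma diffnD k U f g : open U -> diffn k U f -> diffn k U g ->
  diffn k U (f + g).
Proof.
move=> oU; elim: k f g => [|k IH] f g [df Hf] [dg Hg].
  by split=> // x Ux; apply: differentiableD; [exact: df|exact: dg].
split=> [x Ux|v]; first by apply: differentiableD; [exact: df|exact: dg].
apply: diffn_eq oU _ (IH _ _ (Hf v) (Hg v)) => x Ux.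
by rewrite deriveD //; apply: diff_derivable; [exact: df|exact: dg].
Qed.

Lemma diffnM k U f g : open U -> diffn k U f -> diffn k U g ->
  diffn k U (f * g).
Proof.
move=> oU; elim: k f g => [|k IH] f g Pf Pg; case: (Pf) (Pg) => [df Hf] [dg Hg].
  by split=> // x Ux; apply: differentiableM; [exact: df|exact: dg].
split=> [x Ux|v]; first by apply: differentiableM; [exact: df|exact: dg].
have := diffnD oU (IH _ _ (diffnS_le Pf) (Hg v)) (IH _ _ (diffnS_le Pg) (Hf v)).
apply: diffn_eq => // x Ux.
by rewrite deriveM //; apply: diff_derivable; [exact: df|exact: dg].
Qed.

Lemma diffn_sum k U (I : Type) (s : seq I) (F : I -> V -> R) : open U ->
  (forall i, diffn k U (F i)) -> diffn k U (fun x => \sum_(i <- s) F i x).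
Proof.
move=> oU HF; elim: s => [|i s IH].
  by under eq_fun do rewrite big_nil; exact: diffn_cst.
by under eq_fun do rewrite big_cons; exact: diffnD.
Qed.

Lemma diffnV k U f : open U -> (forall x, U x -> f x != 0) ->
  diffn k U f -> diffn k U (fun x => (f x)^-1).
Proof.
move=> oU f0; elim: k => [|k IH] Pf; case: (Pf) => [df Hf].
  by split=> // x Ux; apply: differentiableV; [exact: df|exact: f0].
split=> [x Ux|v]; first by apply: differentiableV; [exact: df|exact: f0].
have Vf := IH (diffnS_le Pf).
apply: (diffn_eq oU) (diffnM oU (diffnM oU (diffn_cst k U (-1)) (Hf v))
  (diffnM oU Vf Vf)) => x Ux.
rewrite deriveV //; [|exact: f0|by apply: diff_derivable; exact: df].
rewrite !fctE /= /GRing.scale /= -exprVn expr2; ring.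
Qed.

(** [foldr] differentiates first along the last vector of the list, so lists are taken apart from
    the right. *)
Lemma smooth_onP U f : smooth_on U f <-> (forall k, diffn k U f).
Proof.
split=> [+ k|+ vs].
  elim: k f => [|k IH] f sf; split=> //; try by move=> x; exact: (sf [::]).
  by move=> v; apply: IH => vs x Ux; have := sf (rcons vs v) x Ux; rewrite foldr_rcons.
elim/last_ind: vs f => [|vs v IH] f sf x Ux; first by case: (sf 0) => + _; apply.
by rewrite foldr_rcons; apply: IH => // k; case: (sf k.+1) => _; exact.
Qed.

End Diffn.

Section DiffnComp.
Context {R : realType} {V : normedModType R} {n : nat}.
Implicit Types (U : set V).

Lemma differentiable_rV (F : V -> 'rV[R]_n) x :
  (forall i, differentiable (fun y => F y 0 i) x) -> differentiable F x.
Proof.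
move=> dF.
have -> : F = \sum_(i < n) (fun y => F y 0 i *: delta_mx 0 i).
  apply/funext => y; rewrite fct_sumE.
  by apply/rowP => j; rewrite [in LHS](row_sum_delta (F y)).
apply: differentiable_sum => i.
exact: differentiableZl.
Qed.

Lemma derive_rV (F : V -> 'rV[R]_n) x v i : differentiable F x ->
  ('D_v F x) 0 i = 'D_v (fun y => F y 0 i) x.
Proof. by move=> dF; rewrite derive_mx ?mxE //; exact: diff_derivable. Qed.

Lemma derive_delta (g : 'rV[R]_n -> R) x v : differentiable g x ->
  'D_v g x = \sum_i v 0 i * 'D_(delta_mx 0 i) g x.
Proof.
move=> dg; rewrite deriveE // {1}(row_sum_delta v) linear_sum.
by apply: eq_bigr => i _; rewrite linearZ /= deriveE.
Qed.

Lemma derive_comp_delta (g : 'rV[R]_n -> R) (F : V -> 'rV[R]_n) x v :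
  (forall i, differentiable (fun y => F y 0 i) x) -> differentiable g (F x) ->
  'D_v (g \o F) x =
  \sum_i 'D_v (fun y => F y 0 i) x * 'D_(delta_mx 0 i) g (F x).
Proof.
move=> dF dg; have dF' := differentiable_rV dF.
rewrite deriveE; last exact: differentiable_comp.
rewrite diff_comp //= -(deriveE v dF') -(deriveE _ dg) derive_delta //.
by apply: eq_bigr => i _; rewrite derive_rV.
Qed.

Lemma diffn_comp k U (U' : set 'rV[R]_n) (g : 'rV[R]_n -> R) (F : V -> 'rV[R]_n) :
  open U -> (forall x, U x -> U' (F x)) -> diffn k U' g ->
  (forall i, diffn k U (fun y => F y 0 i)) -> diffn k U (g \o F).
Proof.
move=> oU FU; elim: k g => [|k IH] g Pg PF.
all: have dgF x : U x -> differentiable (g \o F) x by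
  (move=> Ux; apply: differentiable_comp;
   [apply: differentiable_rV => i; exact: diffn_diff (PF i) Ux
   |exact: diffn_diff Pg (FU _ Ux)]).
  by split.
split=> // v.
(* Chain rule: each term is a derivative of [F] times a partial derivative of [g] composed with [F],
   and the induction hypothesis applies to the latter. *)
have : diffn k U (fun x => \sum_(i < n)
    (('D_v (fun y => F y 0 i)) * ('D_(delta_mx 0 i) g \o F)) x).
  apply: diffn_sum => // i; apply: diffnM => //; first by case: (PF i) => _; apply.
  by apply: IH => [|j]; [by case: Pg => _; apply|exact: diffnS_le (PF j)].
apply: diffn_eq => // x Ux; rewrite derive_comp_delta //.
  by move=> i; exact: diffn_diff (PF i) Ux.
exact: diffn_diff Pg (FU _ Ux).
Qed.

End DiffnComp.

(** * Smooth functions *)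

Section SmoothOn.
Context {R : realType} {V : normedModType R}.
Implicit Types (f g : V -> R) (U : set V).

Lemma smooth_sub U U' f : U' `<=` U -> smooth_on U f -> smooth_on U' f.
Proof. by move=> UU sf vs x /UU; exact: sf. Qed.

Lemma smooth_diff U f x : smooth_on U f -> U x -> differentiable f x.
Proof. by move=> sf Ux; exact: (sf [::]). Qed.

Lemma smooth_continuous U f x : smooth_on U f -> U x -> {for x, continuous f}.
Proof. by move=> sf Ux; apply: differentiable_continuous; exact: smooth_diff sf Ux. Qed.

Lemma smooth_derive U f v : smooth_on U f -> smooth_on U ('D_v f).
Proof. by move=> sf vs x Ux; rewrite -foldr_rcons; exact: sf. Qed.

Lemma smooth_eq U f g : open U -> (forall x, U x -> f x = g x) ->
  smooth_on U f -> smooth_on U g.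
Proof. by move=> oU fg /smooth_onP sf; apply/smooth_onP => k; exact: diffn_eq oU fg _. Qed.

Lemma smooth_cst U (c : R) : smooth_on U (cst c : V -> R).
Proof. by apply/smooth_onP => k; exact: diffn_cst. Qed.

Lemma smoothD U f g : open U -> smooth_on U f -> smooth_on U g ->
  smooth_on U (fun x => f x + g x).
Proof.
by move=> oU /smooth_onP sf /smooth_onP sg; apply/smooth_onP => k; exact: diffnD.
Qed.

Lemma smoothM U f g : open U -> smooth_on U f -> smooth_on U g ->
  smooth_on U (fun x => f x * g x).
Proof.
by move=> oU /smooth_onP sf /smooth_onP sg; apply/smooth_onP => k; exact: diffnM.
Qed.

Lemma smoothN U f : open U -> smooth_on U f -> smooth_on U (fun x => - f x).
Proof.
move=> oU sf; apply: smooth_eq (smoothM oU (smooth_cst (- 1)) sf) => // x _.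
by rewrite /cst mulN1r.
Qed.

Lemma smoothB U f g : open U -> smooth_on U f -> smooth_on U g ->
  smooth_on U (fun x => f x - g x).
Proof. by move=> oU sf sg; apply: smoothD => //; exact: smoothN. Qed.

Lemma smoothV U f : open U -> (forall x, U x -> f x != 0) ->
  smooth_on U f -> smooth_on U (fun x => (f x)^-1).
Proof.
by move=> oU f0 /smooth_onP sf; apply/smooth_onP => k; exact: diffnV.
Qed.

Lemma smooth_comp n U (U' : set 'rV[R]_n) (g : 'rV[R]_n -> R)
    (F : V -> 'rV[R]_n) :
  open U -> (forall x, U x -> U' (F x)) -> smooth_on U' g ->
  (forall i, smooth_on U (fun y => F y 0 i)) -> smooth_on U (g \o F).
Proof.
move=> oU FU /smooth_onP sg sF; apply/smooth_onP => k.
by apply: diffn_comp FU (sg k) _ => // i; have /smooth_onP := sF i.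
Qed.

Lemma smooth_row n U (F : V -> 'rV[R]_n) i : open U -> smooth_on U F ->
  smooth_on U (fun x => F x 0 i).
Proof.
move=> oU sF; apply/smooth_onP => k; elim: k F sF => [|k IH] F sF.
all: have dF x : U x -> differentiable (fun x => F x 0 i) x by
  (move=> Ux; apply: (@differentiable_comp _ _ _ _ F (fun M : 'rV[R]_n => M 0 i));
   [exact: (sF [::])|exact: differentiable_coord]).
  by split.
split=> // v.
have : smooth_on U ('D_v F).
  by move=> vs x Ux; rewrite -foldr_rcons; exact: sF.
move=> /IH; apply: diffn_eq => // x Ux.
by rewrite derive_rV //; exact: (sF [::]).
Qed.

End SmoothOn.

Section RowNorm.
Context {R : realType} {n : nat}.
Implicit Types (x y : 'rV[R]_n).

Lemma coord_le_norm x i : `|x 0 i| <= `|x|.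
Proof.
rewrite [leRHS]/Num.Def.normr /= mx_normrE.
by apply/bigmax_geP; right => /=; exists (0, i).
Qed.

Lemma norm_le_coord x M : 0 <= M -> (forall i, `|x 0 i| <= M) -> `|x| <= M.
Proof.
move=> M0 H; rewrite [leLHS]/Num.Def.normr /= mx_normrE.
by apply/bigmax_leP; split=> //= -[i j] _ /=; rewrite ord1.
Qed.

Lemma derive_coord x v i : 'D_v (fun y : 'rV[R]_n => y 0 i) x = v 0 i.
Proof.
by rewrite -(@derive_rV _ _ _ id x v i) ?derive_id //; exact: differentiable_id.
Qed.

Lemma smooth_coord U i : smooth_on U (fun y : 'rV[R]_n => y 0 i).
Proof.
apply/smooth_onP => -[|k]; split=> //;
  try (by move=> x _; exact: differentiable_coord).
move=> v.
suff -> : 'D_v (fun y : 'rV[R]_n => y 0 i) = cst (v 0 i) by exact: diffn_cst.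
by apply/funext => x; exact: derive_coord.
Qed.

End RowNorm.

(** * The mean value theorem and strict differentiability *)

Section MeanValue.
Context {R : realType} {V : normedModType R}.

Lemma ball_segment (c x y : V) r t : ball c r x -> ball c r y ->
  0 <= t <= 1 -> ball c r (x + t *: (y - x)).
Proof.
rewrite -ball_normE /= => cx cy /andP[t0 t1].
have -> : c - (x + t *: (y - x)) = (1 - t) *: (c - x) + t *: (c - y).
  have -> : y - x = (c - x) - (c - y) by rewrite opprB [RHS]addrC addrA subrK.
  rewrite opprD addrA; move: (c - x) (c - y) => a b.
  by rewrite scalerBr opprB scalerBl scale1r -addrA [- _ + _]addrC.
apply: (@le_lt_trans _ _ ((1 - t) * `|c - x| + t * `|c - y|)).
  apply: le_trans (ler_normD _ _) _.
  by rewrite !normrZ !ger0_norm // subr_ge0.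
move: cx cy; set a := `|c - x|; set b := `|c - y| => ar br.
have [ab|ba] := leP a b.
  have H : 0 <= (1 - t) * (b - a) by rewrite mulr_ge0 // subr_ge0.
  by apply: le_lt_trans br; lra.
have H : 0 <= t * (a - b) by rewrite mulr_ge0 // subr_ge0 ltW.
by apply: le_lt_trans ar; lra.
Qed.

Lemma mean_value (f : V -> R) (x y : V) :
  (forall t, 0 <= t <= 1 -> differentiable f (x + t *: (y - x))) ->
  exists2 t, 0 <= t <= 1 & f y - f x = 'D_(y - x) f (x + t *: (y - x)).
Proof.
move=> df.
pose l := fun t : R => x + t *: (y - x).
have dl (t : R) : is_diff t l (fun s => s *: (y - x)).
  rewrite /l.
  have := @is_diffD _ _ _ (cst x) (fun t : R => t *: (y - x)) _ _ t.
  by move=> /(_ _ _ (is_diff_cst _ _) (is_diff_scalel _ _)); rewrite add0r.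
have dfl (t : R) : 0 <= t <= 1 -> is_derive t 1 (f \o l) ('D_(y - x) f (l t)).
  move=> t01.
  have dl' : differentiable l t by case: (dl t).
  have dfl : differentiable (f \o l) t by apply: differentiable_comp => //; exact: df.
  apply: DeriveDef; first exact: diff_derivable.
  rewrite deriveE // diff_comp //; last exact: df.
  rewrite [RHS]deriveE; last exact: df.
  have E := @diff_val _ _ _ _ _ _ _ (dl t).
  by rewrite /comp E scale1r.
have [|||t t01 E] := @MVT_segment R (f \o l) (fun t => 'D_(y - x) f (l t)) 0 1.
- exact: ler01.
- by move=> t /[!in_itv]/= /andP[t0 t1]; apply: dfl; rewrite !ltW.
- apply: derivable_within_continuous => t /[!in_itv]/= t01.
  by case: (dfl t t01).
exists t; first by move: t01; rewrite in_itv.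
by move: E; rewrite /= /l scale0r addr0 scale1r subr0 mulr1 [x + (y - x)]addrC subrK.
Qed.

End MeanValue.

Section StrictDifferentiability.
Context {R : realType} {n : nat}.
Implicit Types (U : set 'rV[R]_n) (f : 'rV[R]_n -> R).

Lemma derive_bound f x v K : differentiable f x ->
  (forall i, `|'D_(delta_mx 0 i) f x| <= K) -> `|'D_v f x| <= n%:R * K * `|v|.
Proof.
move=> df HK; rewrite derive_delta //.
apply: le_trans (ler_norm_sum _ _ _) _.
apply: (@le_trans _ _ (\sum_(i < n) K * `|v|)).
  apply: ler_sum => i _; rewrite normrM mulrC.
  by apply: ler_pM => //; exact: coord_le_norm.
by rewrite sumr_const card_ord -mulrA mulr_natl.
Qed.

(** By the mean value theorem the increment is the derivative at a point of the segment, and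
    continuity of the partial derivatives lets it be compared with the derivative at any [w] of the
    ball. The freedom in [w] permits a compactness argument along segments later. *)
Lemma uniform_differentiability U f x e : open U -> smooth_on U f -> U x ->
  0 < e -> exists r, [/\ 0 < r, ball x r `<=` U &
    forall y z w, ball x r y -> ball x r z -> ball x r w ->
      `|f z - f y - 'D_(z - y) f w| <= e * `|z - y|].
Proof.
move=> oU sf Ux e0.
pose e' := e / 2 / n.+1%:R.
have e'0 : 0 < e' by rewrite !divr_gt0.
have H1 : \forall y \near x, U y by exact: (open_nbhs_nbhs (conj oU Ux)).
have H2 (i : 'I_n) : \forall y \near x, `|'D_('e_i) f x - 'D_('e_i) f y| < e'.
  by have /cvgrPdist_lt := smooth_continuous (smooth_derive ('e_i) sf) Ux; apply.
have H3 := @filter_forall _ _ (fun i y =>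
  `|'D_('e_i) f x - 'D_('e_i) f y| < e') _ (nbhs_filter x) H2.
have /nbhs_ballP[r r0 Hr] := @filterI _ _ (nbhs_filter x) _ _ H1 H3.
exists r; split=> // [y /Hr[]//|y z w By Bz Bw].
have [t t01|t t01 ->] := @mean_value _ _ f y z.
  by apply: (smooth_diff sf); case: (Hr _ (ball_segment By Bz t01)).
have [Uu Hu] := Hr _ (ball_segment By Bz t01); have [Uw Hw] := Hr _ Bw.
move: (y + _) Uu Hu => u Uu Hu; move: (z - y) => v.
have dfu := smooth_diff sf Uu; have dfw := smooth_diff sf Uw.
have -> : 'D_v f u - 'D_v f w =
    \sum_i v 0 i * ('D_('e_i) f u - 'D_('e_i) f w).
  rewrite !(derive_delta v) // -sumrB.
  by apply: eq_bigr => i _; rewrite mulrBr.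
apply: le_trans (ler_norm_sum _ _ _) _.
apply: (@le_trans _ _ (\sum_(i < n) (e' + e') * `|v|)).
  apply: ler_sum => i _; rewrite normrM mulrC.
  apply: ler_pM => //; last exact: coord_le_norm.
  apply: le_trans (ler_distD ('D_('e_i) f x) _ _) _.
  by rewrite lerD // ltW // distrC.
rewrite sumr_const card_ord -mulrnAl ler_wpM2r //.
have -> : e' + e' = e / n.+1%:R by rewrite /e' -mulrDl -splitr.
by rewrite -mulr_natr mulrAC ler_pdivrMr // ler_pM2l // ler_nat.
Qed.

Lemma strict_differentiability U f x e : open U -> smooth_on U f -> U x ->
  0 < e -> exists r, [/\ 0 < r, ball x r `<=` U &
    forall y z, ball x r y -> ball x r z ->
      `|f z - f y - 'D_(z - y) f x| <= e * `|z - y|].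
Proof.
move=> oU sf Ux e0; have [r [r0 rU H]] := uniform_differentiability oU sf Ux e0.
by exists r; split=> // y z By Bz; apply: H => //; exact: ballxx.
Qed.

Lemma lipschitz_ball U f x : open U -> smooth_on U f -> U x ->
  exists K r, [/\ 0 <= K, 0 < r & forall y z, ball x r y -> ball x r z ->
      `|f z - f y| <= K * `|z - y|].
Proof.
move=> oU sf Ux.
have [r [r0 _ Hr]] := strict_differentiability oU sf Ux ltr01.
pose M := \sum_i `|'D_('e_i) f x|.
have M0 : 0 <= M by apply: sumr_ge0.
exists (1 + n%:R * M), r; split=> //; [by rewrite addr_ge0 // mulr_ge0|move=> y z By Bz].
rewrite -[f z - f y](subrK ('D_(z - y) f x)).
rewrite (le_trans (ler_normD _ _)) // mulrDl lerD //; first exact: Hr.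
apply: derive_bound; first exact: smooth_diff sf Ux.
by move=> i; rewrite /M (bigD1 i) //= lerDl sumr_ge0.
Qed.

Lemma continuous_ball_bounded U f x : open U -> smooth_on U f -> U x ->
  exists M r, [/\ 0 <= M, 0 < r & forall y, ball x r y -> `|f y| <= M].
Proof.
move=> oU sf Ux.
have /cvgrPdist_lt/(_ _ ltr01)/nbhs_ballP[r r0 Hr] := smooth_continuous sf Ux.
exists (`|f x| + 1), r; split=> //; move=> y /Hr /= H.
have := ler_normD (f x) (f y - f x); rewrite addrC subrK distrC => /le_trans; apply.
by rewrite lerD2l ltW.
Qed.

End StrictDifferentiability.

(** * Inverse function theorem *)

HB.instance Definition _ (R : realType) (n : nat) := Complete.on 'rV[R]_n.

Section InverseFunction.
Context {R : realType}.
Local Notation V := 'rV[R]_2.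
Implicit Types (U B : set V) (X : V -> V).

Lemma sum_ord2 (A : nmodType) (F : 'I_2 -> A) : \sum_i F i = F 0 + F 1.
Proof. by rewrite big_ord_recl big_ord1; congr (_ + F _); exact: val_inj. Qed.

Lemma forall_ord2 (P : 'I_2 -> Prop) : P 0 -> P 1 -> forall i, P i.
Proof.
move=> P0 P1 [[|[|//]] ilt].
  by have -> : Ordinal ilt = 0 by exact: val_inj.
by have -> : Ordinal ilt = 1 by exact: val_inj.
Qed.

Definition row2 (a b : R) : V := \row_i (if i == 0 then a else b).

Lemma row2_0 a b : row2 a b 0 0 = a. Proof. by rewrite mxE. Qed.
Lemma row2_1 a b : row2 a b 0 1 = b. Proof. by rewrite mxE. Qed.

Lemma row2P (x y : V) : x 0 0 = y 0 0 -> x 0 1 = y 0 1 -> x = y.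
Proof. by move=> h0 h1; apply/rowP; exact: forall_ord2. Qed.

Definition pd (j i : 'I_2) X (x : V) : R := 'D_('e_j) (fun y => X y 0 i) x.

Definition jac X (x : V) : R := pd 0 0 X x * pd 1 1 X x - pd 1 0 X x * pd 0 1 X x.

(** Cramer's rule; the explicit formula makes the smooth dependence on [x] visible. *)
Definition jac_inv X (x v : V) : V :=
  row2 ((pd 1 1 X x * v 0 0 - pd 1 0 X x * v 0 1) / jac X x)
       ((pd 0 0 X x * v 0 1 - pd 0 1 X x * v 0 0) / jac X x).

Definition tangent_map X (x v : V) : V := \row_i 'D_v (fun y => X y 0 i) x.

Definition smooth_map U X := forall i, smooth_on U (fun y => X y 0 i).

Lemma tangent_mapE U X x v i : smooth_map U X -> U x ->
  tangent_map X x v 0 i = v 0 0 * pd 0 i X x + v 0 1 * pd 1 i X x.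
Proof.
by move=> sX Ux; rewrite mxE derive_delta ?sum_ord2 //; exact: smooth_diff (sX i) Ux.
Qed.

Lemma jac_invK U X x v : smooth_map U X -> U x -> jac X x != 0 ->
  jac_inv X x (tangent_map X x v) = v.
Proof.
move=> sX Ux J0; apply: row2P; rewrite ?row2_0 ?row2_1 !(tangent_mapE _ _ sX Ux);
  move: J0; rewrite /jac => J0; by field.
Qed.

Lemma tangent_mapK U X x v : smooth_map U X -> U x -> jac X x != 0 ->
  tangent_map X x (jac_inv X x v) = v.
Proof.
move=> sX Ux J0; apply: row2P; rewrite !(tangent_mapE _ _ sX Ux) ?row2_0 ?row2_1;
  move: J0; rewrite /jac => J0; by field.
Qed.

Lemma jac_invD X x v w : jac_inv X x (v + w) = jac_inv X x v + jac_inv X x w.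
Proof. by apply: row2P; rewrite !(row2_0, row2_1, mxE) /=; ring. Qed.

Lemma jac_invZ X x (a : R) v : jac_inv X x (a *: v) = a *: jac_inv X x v.
Proof. by apply: row2P; rewrite !(row2_0, row2_1, mxE) /=; ring. Qed.

Lemma jac_inv_bound X x : exists2 K, 0 < K & forall v, `|jac_inv X x v| <= K * `|v|.
Proof.
pose K := 1 + (`|pd 1 1 X x| + `|pd 1 0 X x| + `|pd 0 0 X x| + `|pd 0 1 X x|) /
  `|jac X x|.
have K0 : 0 < K by rewrite ltr_pwDl // divr_ge0 // !addr_ge0.
exists K => // v.
have B a b c d : `|(a * v 0 c - b * v 0 d) / jac X x| <=
    (`|a| + `|b|) / `|jac X x| * `|v|.
  rewrite normrM normfV mulrAC ler_wpM2r // ?invr_ge0 //.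
  rewrite mulrDl (le_trans (ler_normB _ _)) // !normrM.
  by rewrite lerD // ler_wpM2l // coord_le_norm.
apply: norm_le_coord; first by rewrite mulr_ge0 // ltW.
have J0 : 0 <= `|jac X x|^-1 by rewrite invr_ge0.
apply: forall_ord2; rewrite ?row2_0 ?row2_1; apply: le_trans (B _ _ _ _) _;
  rewrite ler_wpM2r // /K -[leLHS]add0r lerD // ler_wpM2r //;
  have := normr_ge0 (pd 1 1 X x); have := normr_ge0 (pd 1 0 X x);
  have := normr_ge0 (pd 0 0 X x); have := normr_ge0 (pd 0 1 X x); lra.
Qed.

Lemma smooth_pd U X j i : smooth_map U X -> smooth_on U (pd j i X).
Proof. by move=> sX; exact: smooth_derive. Qed.

Lemma smooth_jac U X : open U -> smooth_map U X -> smooth_on U (jac X).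
Proof.
by move=> oU sX; apply: smoothB => //; apply: smoothM => //; exact: smooth_pd.
Qed.

Lemma strict_differentiability_map U X x e : open U -> smooth_map U X -> U x ->
  0 < e -> exists r, [/\ 0 < r, ball x r `<=` U &
    forall y z, ball x r y -> ball x r z ->
      `|X z - X y - tangent_map X x (z - y)| <= e * `|z - y|].
Proof.
move=> oU sX Ux e0.
have [r0 [r0_gt0 sub0 H0]] := strict_differentiability oU (sX 0) Ux e0.
have [r1 [r1_gt0 sub1 H1]] := strict_differentiability oU (sX 1) Ux e0.
pose r := Num.min r0 r1.
have b0 : ball x r `<=` ball x r0 by apply: le_ball; rewrite ge_min lexx.
have b1 : ball x r `<=` ball x r1 by apply: le_ball; rewrite ge_min lexx orbT.
exists r; split; [by rewrite lt_min r0_gt0|by move=> y /b0/sub0|move=> y z By Bz].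
apply: norm_le_coord; first by rewrite mulr_ge0 // ltW.
by apply: forall_ord2; rewrite !mxE; [apply: H0; exact: b0|apply: H1; exact: b1].
Qed.

Definition embedding_on B X (Y : V -> V) :=
  [/\ open (X @` B), smooth_map (X @` B) Y & forall x, B x -> Y (X x) = x].

Section LocalInverse.
Variables (U : set V) (X : V -> V) (x0 : V).
Hypotheses (oU : open U) (sX : smooth_map U X) (Ux0 : U x0) (J0 : jac X x0 != 0).

(** Strict differentiability with error [1/(2K)], where [K] bounds the inverse derivative at [x0].
    The first estimate makes Newton's iteration a contraction; the second makes [X] injective with
    Lipschitz inverse. *)
Lemma local_lipschitz_inverse : exists r K, [/\ 0 < r, ball x0 r `<=` U,
  (forall x, ball x0 r x -> jac X x != 0), 0 < K &
  forall y z, ball x0 r y -> ball x0 r z ->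
   `|z - y - jac_inv X x0 (X z - X y)| <= `|z - y| / 2 /\
   `|z - y| <= K * `|X z - X y| ].
Proof.
have [K K0 HK] := jac_inv_bound X x0.
have e0 : 0 < (2 * K)^-1 by rewrite invr_gt0 mulr_gt0.
have [r1 [r1_gt0 sub1 H1]] := strict_differentiability_map oU sX Ux0 e0.
have cJ := smooth_continuous (smooth_jac oU sX) Ux0.
have j0 : 0 < `|jac X x0| by rewrite normr_gt0.
have /cvgrPdist_lt/(_ _ j0)/nbhs_ballP[r2 r2_gt0 H2] := cJ.
pose r := Num.min r1 r2.
have b1 : ball x0 r `<=` ball x0 r1 by apply: le_ball; rewrite ge_min lexx.
have b2 : ball x0 r `<=` ball x0 r2 by apply: le_ball; rewrite ge_min lexx orbT.
exists r, (2 * K); split.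
- by rewrite lt_min r1_gt0.
- by move=> y /b1/sub1.
- move=> x /b2/H2 /=; apply: contraTneq => ->; by rewrite subr0 ltxx.
- by rewrite mulr_gt0.
move=> y z By Bz.
have A : `|z - y - jac_inv X x0 (X z - X y)| <= `|z - y| / 2.
  rewrite -{1}(jac_invK (z - y) sX Ux0 J0) -[- jac_inv _ _ _]scaleN1r -jac_invZ.
  rewrite -jac_invD scaleN1r; apply: le_trans (HK _) _; rewrite distrC.
  apply: le_trans (ler_wpM2l (ltW K0) (H1 _ _ (b1 _ By) (b1 _ Bz))) _.
  by rewrite le_eqVlt; apply/orP; left; apply/eqP; field; rewrite gt_eqF.
split=> //.
have := ler_normD (z - y - jac_inv X x0 (X z - X y)) (jac_inv X x0 (X z - X y)).
rewrite subrK => T; have := HK (X z - X y); lra.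
Qed.


Lemma jac_inv_linear X' (x : V) : linear (jac_inv X' x).
Proof. by move=> a v w; rewrite jac_invD jac_invZ. Qed.

HB.instance Definition _ X' (x : V) :=
  GRing.isLinear.Build R V V _ (jac_inv X' x) (jac_inv_linear X' x).

Lemma jac_inv_continuous X' (x : V) : continuous (jac_inv X' x).
Proof.
have [K K0 HK] := jac_inv_bound X' x.
apply: bounded_linear_continuous; apply/linear_boundedP.
have H : \forall r \near +oo, K <= r by apply: nbhs_pinfty_ge; exact: num_real.
apply: filterS H => r Kr v.
by apply: le_trans (HK v) _; apply: ler_wpM2r.
Qed.

Lemma smooth_jac_inv U' X' v i : open U' -> smooth_map U' X' ->
  (forall x, U' x -> jac X' x != 0) -> smooth_on U' (fun x => jac_inv X' x v 0 i).
Proof.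
move=> oU' sX' J'; have sJ := smoothV oU' J' (smooth_jac oU' sX').
have H j1 i1 j2 i2 a b : smooth_on U' (fun x =>
    (pd j1 i1 X' x * a - pd j2 i2 X' x * b) / jac X' x).
  apply: smoothM => //; apply: smoothB => //; apply: smoothM => //;
    [exact: smooth_pd|exact: smooth_cst|exact: smooth_pd|exact: smooth_cst].
move: i; apply: forall_ord2; [move: (H 1 1 1 0 (v 0 0) (v 0 1))|
  move: (H 0 0 0 1 (v 0 1) (v 0 0))]; by apply: smooth_eq => // x _; rewrite mxE.
Qed.

(** All open [B] in the ball are allowed because later one ball has to serve several maps at
    once. *)
Theorem inverse_function_theorem : exists r K, [/\ 0 < r, ball x0 r `<=` U,
  (forall y z, ball x0 r y -> ball x0 r z -> `|z - y| <= K * `|X z - X y|) &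
  forall B, open B -> B `<=` ball x0 r -> exists Y, embedding_on B X Y].
Proof.
have [r [K [r0 rU rJ K0 HK]]] := local_lipschitz_inverse.
exists r, K; split=> // [y z By Bz|B oB Br]; first by case: (HK _ _ By Bz).
have oXB : open (X @` B).
  rewrite openE => _ [x Bx <-].
  have /nbhs_ballP[e /= e0 eB] : nbhs x B by exact: (open_nbhs_nbhs (conj oB Bx)).
  pose C : set V := closed_ball_ Num.norm x (e / 2).
  have CB : C `<=` B.
    move=> z Cz; apply: eB; rewrite -ball_normE /=; apply: le_lt_trans Cz _; lra.
  have [K1 K10 HK1] := jac_inv_bound X x0.
  (* The iteration moves the centre by at most [e/4] and halves distances, so it preserves the
     closed ball of radius [e/2]. *)
  apply/nbhs_ballP; exists (e / (4 * K1)); first by rewrite /= divr_gt0 // mulr_gt0.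
  move=> y; rewrite -ball_normE /= => Hy.
  (* Newton's iteration for [X z = y] with the derivative frozen at [x0]; its fixed points are the
     solutions. *)
  pose N z := z - jac_inv X x0 (X z - y).
  have NN z w : B z -> B w -> `|N z - N w| <= `|z - w| / 2.
    move=> Bz Bw; have [H _] := HK _ _ (Br _ Bw) (Br _ Bz).
    suff -> : N z - N w = z - w - jac_inv X x0 (X z - X w) by [].
    have -> : jac_inv X x0 (X z - X w) =
        jac_inv X x0 (X z - y) - jac_inv X x0 (X w - y).
      by rewrite -linearB /= opprB addrA subrK.
    by rewrite /N !opprB addrACA [- _ + _]addrC addrACA.
  have NC : {homo N : z / C z >-> C z}.
    move=> z Cz; rewrite /C /closed_ball_ /=.
    have -> : x - N z = (N x - N z) + jac_inv X x0 (X x - y).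
      by rewrite [N x]/N addrAC subrK.
    apply: le_trans (ler_normD _ _) _.
    have Cx : C x by rewrite /C /closed_ball_ /= subrr normr0 divr_ge0 // ltW.
    have H1 := NN _ _ (CB _ Cx) (CB _ Cz).
    have H2 : `|jac_inv X x0 (X x - y)| <= e / 4.
      apply: le_trans (HK1 _) _.
      have -> : e / 4 = K1 * (e / (4 * K1)) by field; rewrite gt_eqF.
      by rewrite ler_pM2l // ltW.
    move: Cz H1 H2; rewrite /C /closed_ball_ /=; lra.
  have ctr : is_contraction [fun of mkfun NC].
    exists (2^-1)%:nng; split=> /=; first by lra.
    by move=> [z w] [/= Cz Cw]; rewrite mulrC; apply: NN; exact: CB.
  have [||p Cp pE] := banach_fixed_point ctr.
  - exact: closed_closed_ball_.
  - by exists x; rewrite /C /closed_ball_ /= subrr normr0 divr_ge0 // ltW.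
  exists p; first exact: CB.
  have {}pE : jac_inv X x0 (X p - y) = 0.
    have : p = p - jac_inv X x0 (X p - y) by exact: pE.
    by move=> /eqP; rewrite -subr_eq0 opprB addrC subrK => /eqP.
  apply/eqP; rewrite -subr_eq0; apply/eqP.
  rewrite -(tangent_mapK (X p - y) sX Ux0 J0) pE.
  by apply/rowP => i; rewrite !mxE derive0.
pose Y y := xget 0 [set x | B x /\ X x = y].
have YP y : (X @` B) y -> B (Y y) /\ X (Y y) = y.
  by move=> [x Bx xy]; exact: (@xgetPex _ 0 [set x | B x /\ X x = y] (ex_intro _ x (conj Bx xy))).
have Binj x z : B x -> B z -> `|z - x| <= K * `|X z - X x|.
  by move=> Bx Bz; have [] := HK _ _ (Br _ Bx) (Br _ Bz).
have YX x : B x -> Y (X x) = x.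
  move=> Bx; have [B1 E] := YP (X x) (imageP X Bx).
  have := Binj _ _ Bx B1; rewrite E subrr normr0 mulr0 normr_le0 subr_eq0.
  by move=> /eqP.
have BU x : B x -> U x by move=> /Br/rU.
have dY x : B x -> differentiable Y (X x) /\
    'd Y (X x) = jac_inv X x :> (V -> V).
  move=> Bx; apply: estimate_differentiable; first exact: jac_inv_continuous.
  move=> e e0.
  have [K1 K10 HK1] := jac_inv_bound X x.
  (* The error for [X] is multiplied by [K1] when the inverse derivative is applied, and by [K] when
     [z - x] is expressed through [h]. *)
  have e'0 : 0 < e / (K1 * K) by rewrite divr_gt0 // mulr_gt0.
  have [s [s0 _ Hs]] := strict_differentiability_map oU sX (BU _ Bx) e'0.
  have nXB : nbhs (X x) (X @` B) by apply: open_nbhs_nbhs; split=> //; exists x.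
  have /nbhs_ballP[t /= t0 tXB] := nXB.
  pose q := Num.min t (s / K).
  apply/nbhs_ballP; exists q => /=; first by rewrite lt_min t0 divr_gt0.
  move=> h; rewrite -ball_normE /= sub0r normrN lt_min => /andP[ht hs].
  have XBh : (X @` B) (h + X x).
    by apply: tXB; rewrite -ball_normE /= opprD addrCA subrr addr0 normrN.
  have [Bz zE] := YP _ XBh; move: (Y (h + X x)) Bz zE => z Bz zE.
  rewrite YX //.
  have hE : h = X z - X x by rewrite zE addrK.
  have dz := Binj _ _ Bx Bz; rewrite -hE in dz.
  have bz : ball x s z.
    rewrite -ball_normE /= distrC; apply: le_lt_trans dz _.
    by rewrite mulrC -ltr_pdivlMr.
  have bx : ball x s x by exact: ballxx.
  rewrite -{1}(jac_invK (z - x) sX (BU _ Bx) (rJ _ (Br _ Bx))).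
  rewrite -[- jac_inv _ _ _]scaleN1r -jac_invZ -jac_invD scaleN1r.
  apply: le_trans (HK1 _) _; rewrite distrC {1}hE.
  apply: le_trans (ler_wpM2l (ltW K10) (Hs _ _ bx bz)) _.
  apply: (@le_trans _ _ (K1 * (e / (K1 * K) * (K * `|h|)))).
    by apply: ler_wpM2l; [exact: ltW|apply: ler_wpM2l; [exact: ltW|]].
  by rewrite le_eqVlt; apply/orP; left; apply/eqP; field; rewrite !gt_eqF.
exists Y; split=> //.
have dYi i y : (X @` B) y -> differentiable (fun y => Y y 0 i) y.
  move=> [x Bx <-].
  apply: (@differentiable_comp _ _ _ _ Y (fun M : V => M 0 i)).
    by case: (dY _ Bx).
  exact: differentiable_coord.
have DY v i y : (X @` B) y ->
    'D_v (fun y => Y y 0 i) y = ((fun x => jac_inv X x v 0 i) \o Y) y.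
  move=> [x Bx <-]; have [dYx EY] := dY _ Bx.
  by rewrite -derive_rV // deriveE // EY /= YX.
(* Bootstrap: [D_v Y] is the smooth map [jac_inv X _ v] composed with [Y], so each order of
   differentiability of [Y] yields the next. *)
suff H k : forall i, diffn k (X @` B) (fun y => Y y 0 i).
  by move=> i; apply/smooth_onP => k; exact: H.
elim: k => [|k IH] i; split=> //; try by move=> y; exact: dYi.
move=> v.
have /smooth_onP sj := smooth_jac_inv v i oB
  (fun i => smooth_sub BU (sX i)) (fun x Bx => rJ _ (Br _ Bx)).
have := diffn_comp oXB (fun y Yy => (YP y Yy).1) (sj k) IH.
by apply: diffn_eq => // y /DY ->.
Qed.

End LocalInverse.
End InverseFunction.

(** * Smooth primitives along a coordinate *)

Section Antiderivative.
Context {R : realType}.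

Lemma antiderivative (g : R -> R) (a b : R) : a < b ->
  (forall t, a <= t <= b -> {for t, continuous g}) ->
  exists G : R -> R, forall t, a < t < b -> is_derive t 1 G (g t).
Proof.
move=> ab cg.
exists (fun x => \int[@lebesgue_measure R]_(t in [set` `[a, x]]) (g t))%R.
move=> t /andP[at_ tb].
have ig : (@lebesgue_measure R).-integrable `[a, b] (EFin \o g).
  apply: continuous_compact_integrable; first exact: segment_compact.
  apply: continuous_in_subspaceT => x; rewrite inE /= in_itv /=; exact: cg.
have [|d1 d2] := continuous_FTC1_closed tb ig at_.
  by apply: cg; rewrite !ltW.
by apply: DeriveDef => //; rewrite -derive1E.
Qed.

Lemma derive_lipschitz (f df : R -> R) (s C a b : R) :
  (forall u : R, `|u| < s -> is_derive u 1 f (df u)) -> `|a| < s -> `|b| < s ->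
  (forall u : R, `|u| < s -> `|u - a| <= `|b - a| -> `|df u| <= C) ->
  `|f b - f a| <= C * `|b - a|.
Proof.
move=> dfd sa sb HC.
have seg t : 0 <= t <= 1 -> `|a + t *: (b - a)| < s.
  move=> t01; have := @ball_segment R R 0 a b s t.
  by rewrite -ball_normE /= !sub0r !normrN; apply.
have [t t01|t t01 ->] := @mean_value R R f a b.
  by apply/derivable1_diffP; case: (dfd _ (seg t t01)).
have [dt E] := dfd _ (seg t t01).
have -> : 'D_(b - a) f (a + t *: (b - a)) = (b - a) * df (a + t *: (b - a)).
  have dft : differentiable f (a + t *: (b - a)) by apply/derivable1_diffP.
  by rewrite deriveE // (deriv1E dt) derive1E E.
rewrite normrM mulrC ler_wpM2r //; apply: HC; first exact: seg.
case/andP: t01 => t0 t1.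
by rewrite addrC addKr normrZ ger0_norm // -[leRHS]mul1r ler_wpM2r.
Qed.

End Antiderivative.

Section Primitive.
Context {R : realType} {n : nat}.
Local Notation V := 'rV[R]_n.
Variables (c : V) (r : R) (i : 'I_n).
Hypothesis r0 : 0 < r.
Local Notation s := (r / 2).
Local Notation e := ('e_i : V).

Let s0 : 0 < s. Proof. by rewrite divr_gt0. Qed.
Let obr : open (ball c r). Proof. exact: ball_open. Qed.
Let s_lt_r : s < r. Proof. by move: r0; lra. Qed.
Let Ns_lt_s : - s < s. Proof. by move: r0; lra. Qed.

(** Projection along [e] to the hyperplane through the centre, from which primitives are
    integrated. *)
Definition base_point (x : V) : V := x + (c 0 i - x 0 i) *: e.
Local Notation pi := base_point.

Lemma base_point_coord x : pi x 0 i = c 0 i.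
Proof. by rewrite !mxE !eqxx mulr1 addrC subrK. Qed.

Lemma base_pointK x : pi x + (x 0 i - c 0 i) *: e = x.
Proof. by rewrite /base_point -addrA -scalerDl addrA subrK subrr scale0r addr0. Qed.

Lemma base_point_line x t : pi (pi x + t *: e) = pi x.
Proof.
have -> : pi (pi x + t *: e) =
    pi x + t *: e + (c 0 i - (pi x + t *: e) 0 i) *: e by [].
rewrite [X in c 0 i - X]mxE base_point_coord !mxE !eqxx mulr1 opprD addrA subrr.
by rewrite sub0r scaleNr addrK.
Qed.

Lemma ball_coord (x y : V) q : 0 < q ->
  ball x q y <-> forall j, `|x 0 j - y 0 j| < q.
Proof.
move=> q0; rewrite -ball_normE /=; split=> [H j|H].
  apply: le_lt_trans H; have := coord_le_norm (x - y) j.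
  by rewrite !mxE.
rewrite [ltLHS]/Num.Def.normr /= mx_normrE; apply/bigmax_ltP; split=> //= -[a j] _ /=.
by rewrite ord1 !mxE; exact: H.
Qed.

(** Balls of the sup norm are cubes, so one coordinate can be changed freely within the radius. *)
Lemma ball_line x t q : 0 < q -> ball c q x -> `|t| < q ->
  ball c q (pi x + t *: e).
Proof.
move=> q0 /(ball_coord _ _ q0) Hx tq; apply/ball_coord => // j.
have [->|ji] := eqVneq j i.
  by rewrite mxE base_point_coord !mxE !eqxx mulr1 opprD addrA subrr sub0r normrN.
by rewrite !mxE (negbTE ji) andbF !mulr0 !addr0.
Qed.

Lemma ball_coord_offset x q : 0 < q -> ball c q x -> `|x 0 i - c 0 i| < q.
Proof. by move=> q0 /(ball_coord _ _ q0)/(_ i); rewrite distrC. Qed.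

(** Vanishing on the hyperplane ties together the constants of integration on parallel lines. *)
Definition primitive (v P : V -> R) := forall x : V, ball c s x ->
  P (pi x) = 0 /\ forall t : R, `|t| < s ->
    is_derive t 1 (fun u => P (pi x + u *: e)) (v (pi x + t *: e)).

Lemma primitive_exists v : smooth_on (ball c r) v -> exists P, primitive v P.
Proof.
move=> sv.
have H y : exists G : R -> R, ball c s y -> forall t : R, `|t| < s ->
    is_derive t 1 G (v (pi y + t *: e)).
  have [By|nBy] := pselect (ball c s y); last by exists (cst 0).
  have [G HG] : exists G : R -> R, forall t : R, - s < t < s ->
      is_derive t 1 G (v (pi y + t *: e)).
    (* The integrand must be continuous on a closed segment of half-length [s]; this segment lies in
       the open ball of radius [r], which is why the radius is halved. *)
    apply: (@antiderivative R (fun t => v (pi y + t *: e))) => //.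
    move=> t ts; apply: continuous_comp.
      apply: continuousD; first exact: cst_continuous.
      exact: scalel_continuous.
    apply: smooth_continuous sv _; apply: ball_line => //.
      by apply: le_ball By; exact: ltW.
    by apply: (@le_lt_trans _ _ s); [rewrite ler_norml|].
  by exists G => _ t; rewrite ltr_norml; exact: HG.
have [G HG] := choice H.
(* [G] is chosen on each line separately, with no regularity across lines; subtracting its value at
   [0] normalizes it. *)
exists (fun x => G (pi x) (x 0 i - c 0 i) - G (pi x) 0) => x Bx.
have Bpi : ball c s (pi x).
  have := @ball_line x 0 s s0 Bx; rewrite normr0 scale0r addr0; exact.
have pipi : pi (pi x) = pi x.
  by have := base_point_line x 0; rewrite scale0r addr0.
split; first by rewrite pipi base_point_coord subrr subrr.
move=> t ts.
have -> : (fun u => G (pi (pi x + u *: e)) ((pi x + u *: e) 0 i - c 0 i) -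
     G (pi (pi x + u *: e)) 0) = (fun u => G (pi x) u - G (pi x) 0).
  apply/funext => u; rewrite base_point_line mxE base_point_coord !mxE !eqxx mulr1.
  by rewrite addrC addKr.
have := HG _ Bpi t ts; rewrite pipi => D.
by apply: is_derive_eq; rewrite subr0.
Qed.

(** Compactness of the segment gives one radius [q] for all its points, as differentiation under the
    integral sign requires. *)
Lemma uniform_differentiability_line (v : V -> R) (y : V) (a eps : R) :
  smooth_on (ball c r) v ->
  0 < eps -> 0 <= a -> (forall u : R, `|u| <= a -> ball c r (y + u *: e)) ->
  exists2 q, 0 < q & forall (u : R) (k : V), `|u| <= a -> `|k| < q ->
    `|v (y + u *: e + k) - v (y + u *: e) - 'D_k v (y + u *: e)| <= eps * `|k|.
Proof.
move=> sv eps0 a0 Hy.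
have cK : compact `[- a, a]%classic by exact: segment_compact.
move/compact_near_coveringP : cK => cK.
pose P (k : V) (u : R) :=
  `|v (y + u *: e + k) - v (y + u *: e) - 'D_k v (y + u *: e)| <= eps * `|k|.
have NC : nbhs (0 : V) (fun k => `[- a, a]%classic `<=` P k).
  apply: (cK V (nbhs (0 : V)) P (nbhs_filter _)).
  move=> u /=; rewrite in_itv /= -ler_norml => /Hy Bu.
  have [q [q0 qB Hq]] := uniform_differentiability obr sv Bu eps0.
  have q20 : 0 < q / 2 by rewrite divr_gt0.
  have [K K0 HK] : exists2 K, 0 < K & `|e| <= K.
    by exists (1 + `|e|); [rewrite ltr_pwDl|rewrite lerDr].
  exists (ball u (q / 2 / K), ball (0 : V) (q / 2)) => /=.
    split; apply: nbhsx_ballx => //; by rewrite divr_gt0.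
  move=> [u' k] /= []; rewrite -!ball_normE /= sub0r normrN => Hu Hk.
  have N : `|(u' - u) *: e| < q / 2.
    rewrite normrZ distrC; move: Hu; rewrite ltr_pdivlMr //; apply: le_lt_trans.
    by rewrite ler_wpM2l.
  have B1 : ball (y + u *: e) q (y + u' *: e).
    rewrite -ball_normE /= distrC opprD addrACA subrr add0r -scalerBl.
    by apply: lt_trans N _; lra.
  have B2 : ball (y + u *: e) q (y + u' *: e + k).
    rewrite -ball_normE /= distrC opprD addrAC addrACA subrr add0r -scalerBl.
    by apply: le_lt_trans (ler_normD _ _) _; lra.
  have := Hq _ _ _ B1 B2 B1.
  by rewrite /P [y + u' *: e + k - _]addrC addKr.
move/nbhs_ballP : NC => [q /= q0 Hq]; exists q => // u k ua kq.
by apply: Hq; [rewrite -ball_normE /= sub0r normrN|rewrite /= in_itv /= -ler_norml].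
Qed.

Definition row_form (a w : V) : R := \sum_j w 0 j * a 0 j.

Lemma row_form_linear a : linear (row_form a).
Proof.
move=> b w1 w2; rewrite /row_form /= scaler_sumr -big_split /=; apply: eq_bigr => j _.
by rewrite !mxE mulrDl /GRing.scale /= mulrA.
Qed.

HB.instance Definition _ a :=
  GRing.isLinear.Build R V R _ (row_form a) (row_form_linear a).

Lemma row_form_continuous a : continuous (row_form a).
Proof.
apply: bounded_linear_continuous; apply/linear_boundedP.
have H : \forall M \near +oo, \sum_j `|a 0 j| <= M.
  by apply: nbhs_pinfty_ge; exact: num_real.
apply: filterS H => M HM w; apply: le_trans (ler_norm_sum _ _ _) _.
apply: (@le_trans _ _ ((\sum_j `|a 0 j|) * `|w|)); last exact: ler_wpM2r.
rewrite mulr_suml; apply: ler_sum => j _; rewrite normrM mulrC ler_wpM2l //.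
exact: coord_le_norm.
Qed.

(** Differentiation under the integral sign: the transverse partial derivatives of [P] are the
    primitives [Q j] of those of [v]. The increment is split into a step across lines and a step
    along one, each estimated by the mean value theorem. *)
Lemma primitive_differentiable (v P : V -> R) (Q : 'I_n -> V -> R) x :
  smooth_on (ball c r) v -> primitive v P ->
  (forall j, primitive ('D_('e_j) v) (Q j)) -> ball c s x ->
  differentiable P x /\
  forall w, 'D_w P x = \sum_j w 0 j * (if j == i then v x else Q j x).
Proof.
move=> sv HP HQ Bx.
pose a : V := \row_j (if j == i then v x else Q j x).
suff [dP EP] : differentiable P x /\ 'd P x = row_form a :> (V -> R).
  split=> // w; rewrite deriveE // EP; apply: eq_bigr => j _; by rewrite mxE.
apply: estimate_differentiable; first exact: row_form_continuous.
move=> eps eps0.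
have BrS : ball c s `<=` ball c r by apply: le_ball; exact: ltW.
pose t := x 0 i - c 0 i; pose y := pi x.
have xE : x = y + t *: e by rewrite /y /t base_pointK.
have ts : `|t| < s by exact: ball_coord_offset.
(* This error is integrated over a length below [s], hence the division by [s]. *)
have [q1 q10 Hq1] : exists2 q, 0 < q & forall u (k : V), `|u| <= `|t| ->
    `|k| < q ->
    `|v (y + u *: e + k) - v (y + u *: e) - 'D_k v (y + u *: e)| <= eps / 2 / s * `|k|.
  apply: uniform_differentiability_line => //; first by rewrite !divr_gt0.
  move=> u ut; apply: ball_line => //; first exact: BrS.
  by apply: le_lt_trans ut _; exact: lt_trans ts _.
have e20 : 0 < eps / 2 by rewrite divr_gt0.
have /cvgrPdist_lt/(_ _ e20)/nbhs_ballP[q2 /= q20 Hq2] :=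
  smooth_continuous sv (BrS _ Bx).
have /nbhs_ballP[q3 /= q30 Hq3] : nbhs x (ball c s).
  by apply: open_nbhs_nbhs; split=> //; exact: ball_open.
pose q := Num.min q1 (Num.min q2 q3).
apply/nbhs_ballP; exists q; first by rewrite /= !lt_min q10 q20.
move=> h; rewrite -ball_normE /= sub0r normrN !lt_min => /and3P[hq1 hq2 hq3].
have Bxh : ball c s (h + x).
  by apply: Hq3; rewrite -ball_normE /= opprD addrCA subrr addr0 normrN.
pose k := h - h 0 i *: e.
have kcoord j : k 0 j = if j == i then 0 else h 0 j.
  rewrite !mxE eqxx /=; case: eqVneq => [->|]; first by rewrite mulr1 subrr.
  by rewrite mulr0 subr0.
have kh : `|k| <= `|h|.
  apply: norm_le_coord => // j; rewrite kcoord; case: eqVneq => _.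
    by rewrite normr0.
  exact: coord_le_norm.
pose t' := (h + x) 0 i - c 0 i; pose y' := pi (h + x).
have y'E : y' = y + k.
  by apply/rowP => j; rewrite /y' /y /k /base_point !mxE; ring.
have xhE : h + x = y' + t' *: e by rewrite /y' /t' base_pointK.
have ts' : `|t'| < s by exact: ball_coord_offset.
have t'E : t' - t = h 0 i by rewrite /t' /t mxE opprB addrA subrK addrK.
have [_ dP1] := HP _ Bxh; have [P0 dP0] := HP _ Bx.
have P'0 := (HP _ Bxh).1.
(* Along the line through [h + x] the derivative [v] stays within [eps/2] of [v x]. *)
have F1 : `|(P (y' + t' *: e) - t' * v x) - (P (y' + t *: e) - t * v x)| <=
    eps / 2 * `|t' - t|.
  apply: (@derive_lipschitz R (fun u => P (y' + u *: e) - u * v x)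
    (fun u => v (y' + u *: e) - v x) s) => // u us.
    have D := dP1 u us.
    by apply: is_derive_eq; rewrite scaler0 add0r /GRing.scale /= mulr1.
  move=> Hu; rewrite distrC ltW //; apply: Hq2; rewrite -ball_normE /=.
  apply: le_lt_trans hq2; rewrite {1}xE y'E; apply: norm_le_coord => // j.
  have -> : (y + t *: e - (y + k + u *: e)) 0 j = - (k 0 j + (u - t) * e 0 j).
    by rewrite !mxE; ring.
  rewrite normrN kcoord !mxE eqxx /=; case: (eqVneq j i) => [_|_] /=.
    rewrite add0r mulr1; apply: le_trans Hu _; rewrite t'E; exact: coord_le_norm.
  by rewrite mulr0 addr0; exact: coord_le_norm.
pose S u := \sum_j k 0 j * Q j (y + u *: e).
(* Across lines: the difference of the two primitives minus its linear part [S] vanishes at [u = 0]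
   by normalization, and its derivative in [u] is the error bounded by [Hq1]. *)
have F2 : `|(P (y' + t *: e) - P (y + t *: e) - S t) -
    (P (y' + 0 *: e) - P (y + 0 *: e) - S 0)| <= eps / 2 / s * `|h| * `|t - 0|.
  apply: (@derive_lipschitz R (fun u => P (y' + u *: e) - P (y + u *: e) - S u)
    (fun u => v (y' + u *: e) - v (y + u *: e) - 'D_k v (y + u *: e)) s) => //.
  - move=> u us; have D1 := dP1 u us; have D0 := dP0 u us.
    have DS : is_derive u 1 S ('D_k v (y + u *: e)).
      rewrite (derive_delta k); last first.
        apply: (smooth_diff sv); apply: ball_line => //; first exact: BrS.
        exact: lt_trans us _.
      rewrite /S.
      have -> : (fun u => \sum_j k 0 j * Q j (y + u *: e)) =
          \sum_j (k 0 j *: (fun u => Q j (y + u *: e))).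
        by apply/funext => z; rewrite fct_sumE.
      apply: is_derive_sum => j; apply: is_deriveZ.
      by have [_] := HQ j _ Bx; apply.
    exact: is_deriveB.
  - by rewrite normr0.
  move=> u us; rewrite !subr0 => ut.
  have -> : y' + u *: e = y + u *: e + k by rewrite y'E addrAC.
  apply: le_trans (Hq1 _ _ ut (le_lt_trans kh hq1)) _.
  by rewrite ler_wpM2l // !divr_ge0 // ltW.
have Q0 j : Q j y = 0 by have [] := HQ j _ Bx.
have S0 : S 0 = 0.
  by rewrite /S big1 // => j _; rewrite scale0r addr0 Q0 mulr0.
have F2' : `|P (y' + t *: e) - P (y + t *: e) - S t| <= eps / 2 * `|h|.
  move: F2; rewrite S0 !scale0r !addr0 P0 P'0 !subr0 => F2.
  apply: le_trans F2 _.
  have -> : eps / 2 / s * `|h| * `|t| = eps / 2 * `|h| * (`|t| / s) by ring.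
  rewrite -[leRHS]mulr1 ler_wpM2l // ?mulr_ge0 // ?divr_ge0 ?(ltW eps0) //.
  by rewrite ler_pdivrMr // mul1r ltW.
have LE : row_form a h = h 0 i * v x + S t.
  rewrite /row_form /S -xE (bigD1 i) //= [in RHS](bigD1 i) //= kcoord eqxx mul0r.
  rewrite add0r !mxE eqxx; congr (_ + _); apply: eq_bigr => j ji.
  by rewrite kcoord !mxE (negbTE ji).
rewrite LE {1}xhE {1}xE.
have -> : P (y' + t' *: e) - P (y + t *: e) - (h 0 i * v x + S t) =
   ((P (y' + t' *: e) - t' * v x) - (P (y' + t *: e) - t * v x)) +
   (P (y' + t *: e) - P (y + t *: e) - S t) by rewrite -t'E; ring.
apply: le_trans (ler_normD _ _) _.
have hi : `|t' - t| <= `|h| by rewrite t'E; exact: coord_le_norm.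
have : eps / 2 * `|t' - t| <= eps / 2 * `|h| by rewrite ler_wpM2l // ltW.
lra.
Qed.

(** Every partial derivative of a primitive is the function itself or a primitive of one of its
    derivatives, so smoothness follows by induction on the order for all functions at once. The
    mixed derivatives are read off from the same description. *)
Theorem smooth_primitive (v : V -> R) : smooth_on (ball c r) v ->
  exists P, smooth_on (ball c s) P /\
    forall x, ball c s x -> 'D_('e_i) P x = v x /\
      forall j, 'D_('e_i) ('D_('e_j) P) x = 'D_('e_j) v x.
Proof.
have main k : forall (v P : V -> R), smooth_on (ball c r) v -> primitive v P ->
    diffn k (ball c s) P.
  elim: k => [|k IH] w P sw HP;
    have [Q HQ] := choice (fun j => primitive_exists (smooth_derive ('e_j) sw));
    have D x := @primitive_differentiable w P Q x sw HP HQ.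
    by split=> // x /D[].
  split=> [x /D[]//|u].
  have os : open (ball c s) by exact: ball_open.
  have BrS : ball c s `<=` ball c r by apply: le_ball; exact: ltW.
  have : diffn k (ball c s) (fun x => \sum_j u 0 j * (if j == i then w x else Q j x)).
    apply: diffn_sum => // j; apply: diffnM => //; first exact: diffn_cst.
    case: eqVneq => _; last by apply: IH (HQ j); exact: smooth_derive.
    by have /smooth_onP := smooth_sub BrS sw.
  by apply: diffn_eq => // x /D[_ ->].
have Dii f P : smooth_on (ball c r) f -> primitive f P ->
    forall x, ball c s x -> 'D_('e_i) P x = f x.
  move=> sf HP x Bx.
  have [Q HQ] := choice (fun j => primitive_exists (smooth_derive ('e_j) sf)).
  have [_ ->] := primitive_differentiable sf HP HQ Bx.
  rewrite (bigD1 i) //= !mxE !eqxx mul1r big1 ?addr0 // => j ji.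
  by rewrite !mxE (negbTE ji) andbF mul0r.
have obs : open (ball c s) by exact: ball_open.
move=> sv; have [P HP] := primitive_exists sv.
exists P; split; first by apply/smooth_onP => k; exact: main HP.
move=> x Bx; split; first exact: Dii HP _ Bx.
have [Q HQ] := choice (fun j => primitive_exists (smooth_derive ('e_j) sv)).
have DP j y : ball c s y -> (if j == i then v y else Q j y) = 'D_('e_j) P y.
  move=> By; have [_ ->] := primitive_differentiable sv HP HQ By.
  rewrite (bigD1 j) //= !mxE !eqxx mul1r big1 ?addr0 // => l lj.
  by rewrite !mxE (negbTE lj) andbF mul0r.
move=> j; have [->|ji] := eqVneq j i.
  have nv : \forall y \near x, v y = 'D_('e_i) P y.
    apply: filterS (open_nbhs_nbhs (conj obs Bx)) => y By.
    by rewrite -DP // eqxx.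
  by rewrite -(near_eq_derive _ nv).
rewrite -(Dii _ _ (smooth_derive ('e_j) sv) (HQ j) x Bx).
apply: near_eq_derive.
apply: filterS (open_nbhs_nbhs (conj obs Bx)) => y By.
by rewrite -DP // (negbTE ji).
Qed.

End Primitive.

(** * Local factorization into gradient maps *)

Section DeriveRules.
Context {R : realType} {V : normedModType R}.
Implicit Types (f g : V -> R) (x v : V).

Lemma derive_add f g x v : differentiable f x -> differentiable g x ->
  'D_v (fun y => f y + g y) x = 'D_v f x + 'D_v g x.
Proof. by move=> df dg; apply: deriveD; exact: diff_derivable. Qed.

Lemma derive_sub f g x v : differentiable f x -> differentiable g x ->
  'D_v (fun y => f y - g y) x = 'D_v f x - 'D_v g x.
Proof. by move=> df dg; apply: deriveB; exact: diff_derivable. Qed.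

Lemma derive_mul f g x v : differentiable f x -> differentiable g x ->
  'D_v (fun y => f y * g y) x = f x * 'D_v g x + g x * 'D_v f x.
Proof. by move=> df dg; apply: deriveM; exact: diff_derivable. Qed.

Lemma derive_scale (a : R) f x v : differentiable f x ->
  'D_v (fun y => a * f y) x = a * 'D_v f x.
Proof. by move=> df; rewrite derive_mul // derive_cst mulr0 addr0. Qed.

Lemma derive_half_sqr f x v : differentiable f x ->
  'D_v (fun y => f y * f y / 2) x = f x * 'D_v f x.
Proof.
move=> df; rewrite (_ : (fun y => _) = (fun y => 2^-1 * (f y * f y))); last first.
  by apply/funext => y; rewrite mulrC.
rewrite derive_scale; last exact: differentiableM.
by rewrite derive_mul //; field.
Qed.

End DeriveRules.

Section LocalFactorization.
Context {R : realType}.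
Local Notation V := 'rV[R]_2.
Implicit Types (U B : set V) (X Y F : V -> V) (S : V -> R).

(* dS = Q . dP on B *)
Definition potential B S (P Q : V -> V) := forall x, B x -> forall w,
  'D_w S x = Q x 0 0 * 'D_w (fun y => P y 0 0) x + Q x 0 1 * 'D_w (fun y => P y 0 1) x.

Lemma pd_comp U U' X Y x j i : smooth_map U X -> smooth_map U' Y -> U x ->
  U' (X x) -> pd j i (Y \o X) x =
    pd j 0 X x * pd 0 i Y (X x) + pd j 1 X x * pd 1 i Y (X x).
Proof.
move=> sX sY Ux UX.
have -> : pd j i (Y \o X) x = 'D_('e_j) ((fun y => Y y 0 i) \o X) x by [].
rewrite derive_comp_delta ?sum_ord2 //; first by move=> k; exact: smooth_diff (sX k) Ux.
exact: smooth_diff (sY i) UX.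
Qed.

Lemma jac_comp U U' X Y x : smooth_map U X -> smooth_map U' Y -> U x ->
  U' (X x) -> jac (Y \o X) x = jac Y (X x) * jac X x.
Proof.
move=> sX sY Ux UX; rewrite {1}/jac !(pd_comp _ _ sX sY Ux UX) /jac; ring.
Qed.

Lemma smooth_map_comp U U' X Y : open U -> smooth_map U X -> smooth_map U' Y ->
  (forall x, U x -> U' (X x)) -> smooth_map U (Y \o X).
Proof. by move=> oU sX sY UX i; exact: smooth_comp oU UX (sY i) sX. Qed.

Lemma smooth_map_row2 U (f g : V -> R) : open U -> smooth_on U f ->
  smooth_on U g -> smooth_map U (fun x => row2 (f x) (g x)).
Proof.
move=> oU sf sg; apply: forall_ord2.
  by apply: smooth_eq sf => // x _; rewrite row2_0.
by apply: smooth_eq sg => // x _; rewrite row2_1.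
Qed.

Lemma row2_0E (f g : V -> R) : (fun x => row2 (f x) (g x) 0 0) = f.
Proof. by apply/funext => x; rewrite row2_0. Qed.

Lemma row2_1E (f g : V -> R) : (fun x => row2 (f x) (g x) 0 1) = g.
Proof. by apply/funext => x; rewrite row2_1. Qed.

Lemma jac_row2 (f g : V -> R) x : jac (fun y => row2 (f y) (g y)) x =
  'D_('e_0) f x * 'D_('e_1) g x - 'D_('e_1) f x * 'D_('e_0) g x.
Proof. by rewrite /jac /pd row2_0E row2_1E. Qed.

(* H with H_1 = F_1, the free parameter lam making grad H nondegenerate. *)
Lemma first_gradient U F x0 : open U -> smooth_map U F -> U x0 -> jac F x0 != 0 ->
  exists r X H, [/\ 0 < r, ball x0 r `<=` U,
    smooth_map (ball x0 r) X /\ smooth_on (ball x0 r) H, jac X x0 < 0 &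
    (forall x, ball x0 r x -> X x 0 1 = F x 0 1) /\ potential (ball x0 r) H id X].
Proof.
move=> oU sF Ux0 J0.
have /nbhs_ballP[r0 /= r00 r0U] : nbhs x0 U by exact: open_nbhs_nbhs.
have sv : smooth_on (ball x0 r0) (fun y => F y 0 1) by exact: smooth_sub (sF 1).
have [P [sP HP]] := smooth_primitive 1 r00 sv.
set r := r0 / 2 in sP HP.
have r_gt0 : 0 < r by rewrite divr_gt0.
have rr0 : ball x0 r `<=` ball x0 r0 by apply: le_ball; rewrite /r; lra.
have oB : open (ball x0 r) by exact: ball_open.
have Bx0 : ball x0 r x0 by exact: ballxx.
(* As [D_1 D_0 P = D_0 F_1], this choice makes the Jacobian at [x0] minus the squared length of the
   gradient of [F_1], which is nonzero because [jac F x0] is. *)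
pose lam := - 'D_('e_0) ('D_('e_0) P) x0 - 'D_('e_1) (fun y => F y 0 1) x0.
have s0 : smooth_on (ball x0 r) (fun x : V => x 0 0) by exact: smooth_coord.
have sl : smooth_on (ball x0 r) (fun x : V => lam * x 0 0).
  by apply: smoothM => //; exact: smooth_cst.
have sDP j : smooth_on (ball x0 r) ('D_('e_j) P) by exact: smooth_derive.
pose X x := row2 ('D_('e_0) P x + lam * x 0 0) (F x 0 1).
pose H x := P x + lam * (x 0 0 * x 0 0 / 2).
have svr : smooth_on (ball x0 r) (fun y => F y 0 1) by exact: smooth_sub sv.
have sq : smooth_on (ball x0 r) (fun x : V => x 0 0 * x 0 0 / 2).
  by apply: smoothM => //; [exact: smoothM|exact: smooth_cst].
exists r, X, H; split=> //.
- by move=> x /rr0/r0U.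
- split; first by apply: smooth_map_row2 => //; exact: smoothD.
  by apply: smoothD => //; apply: smoothM => //; exact: smooth_cst.
- have d0 : differentiable ('D_('e_0) P) x0 by exact: smooth_diff (sDP 0) Bx0.
  have dl : differentiable (fun x : V => lam * x 0 0) x0 by exact: smooth_diff sl Bx0.
  have dc : differentiable (fun x : V => x 0 0) x0 by exact: smooth_diff s0 Bx0.
  rewrite jac_row2 !(derive_add _ d0 dl) !(derive_scale _ _ dc) !derive_coord.
  rewrite (HP _ Bx0).2 !mxE !eqxx /= mulr0 addr0 mulr1.
  have -> : 'D_('e_0) ('D_('e_0) P) x0 + lam = - 'D_('e_1) (fun y => F y 0 1) x0.
    by rewrite /lam; ring.
  have J1 : ('D_('e_0) (fun y => F y 0 1) x0 != 0) || ('D_('e_1) (fun y => F y 0 1) x0 != 0).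
    apply: contraNT J0; rewrite negb_or !negbK => /andP[/eqP e0 /eqP e1].
    by rewrite /jac /pd e0 e1 !mulr0 subrr.
  have key (a b : R) : (a != 0) || (b != 0) -> - b * b - a * a < 0.
    move=> ab; have -> : - b * b - a * a = - (a ^+ 2 + b ^+ 2) by ring.
    rewrite oppr_lt0.
    by rewrite lt_neqAle addr_ge0 ?sqr_ge0 // andbT eq_sym paddr_eq0 ?sqr_ge0 // !sqrf_eq0 negb_and.
  exact: key J1.
split; first by move=> x _; rewrite row2_1.
move=> x Bx w; rewrite row2_0 row2_1.
have dP := smooth_diff sP Bx.
have dc : differentiable (fun x : V => x 0 0) x by exact: smooth_diff s0 Bx.
have dq := smooth_diff sq Bx.
rewrite derive_add //; last by apply: smooth_diff Bx; apply: smoothM => //; exact: smooth_cst.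
rewrite derive_scale // derive_half_sqr // !derive_coord (derive_delta w dP) sum_ord2.
rewrite (HP _ Bx).1; ring.
Qed.

(** With [a = D_0 u p0] and [b = D_1 u p0], the derivative of [Q] at [p0] is symmetric with diagonal
    [a - 1], [D_1 D_1 P + kap] and off-diagonal entry [b]. As [a - 1] is nonzero, the other diagonal
    entry controls the determinant; setting it to [-(1 + b^2)] gives [1 - a - a b^2 > 0]. *)
Lemma second_gradient U (u : V -> R) p0 : open U -> smooth_on U u -> U p0 ->
  'D_('e_0) u p0 < 0 ->
  exists r Q K, [/\ 0 < r, ball p0 r `<=` U,
    smooth_map (ball p0 r) Q /\ smooth_on (ball p0 r) K, 0 < jac Q p0 &
    (forall p, ball p0 r p -> Q p 0 0 = u p - p 0 0) /\ potential (ball p0 r) K id Q].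
Proof.
move=> oU su Up0 u0.
have /nbhs_ballP[r0 /= r00 r0U] : nbhs p0 U by exact: open_nbhs_nbhs.
have sv : smooth_on (ball p0 r0) u by exact: smooth_sub su.
have [P [sP HP]] := smooth_primitive 0 r00 sv.
set r := r0 / 2 in sP HP.
have r_gt0 : 0 < r by rewrite divr_gt0.
have rr0 : ball p0 r `<=` ball p0 r0 by apply: le_ball; rewrite /r; lra.
have oB : open (ball p0 r) by exact: ball_open.
have Bp0 : ball p0 r p0 by exact: ballxx.
have sur : smooth_on (ball p0 r) u by exact: smooth_sub sv.
pose kap := - 'D_('e_1) ('D_('e_1) P) p0 - (1 + 'D_('e_1) u p0 * 'D_('e_1) u p0).
have sc i : smooth_on (ball p0 r) (fun x : V => x 0 i) by exact: smooth_coord.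
have sq i : smooth_on (ball p0 r) (fun x : V => x 0 i * x 0 i / 2).
  by apply: smoothM => //; [exact: smoothM|exact: smooth_cst].
have sl : smooth_on (ball p0 r) (fun x : V => kap * x 0 1).
  by apply: smoothM => //; exact: smooth_cst.
have sql : smooth_on (ball p0 r) (fun x : V => kap * (x 0 1 * x 0 1 / 2)).
  by apply: smoothM => //; exact: smooth_cst.
have sDP : smooth_on (ball p0 r) ('D_('e_1) P) by exact: smooth_derive.
have sPq : smooth_on (ball p0 r) (fun x : V => P x - x 0 0 * x 0 0 / 2).
  exact: smoothB.
pose Q p := row2 (u p - p 0 0) ('D_('e_1) P p + kap * p 0 1).
pose K p := P p - p 0 0 * p 0 0 / 2 + kap * (p 0 1 * p 0 1 / 2).
exists r, Q, K; split=> //.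
- by move=> x /rr0/r0U.
- by split; [apply: smooth_map_row2 => //; [exact: smoothB|exact: smoothD]|exact: smoothD].
- rewrite jac_row2.
  have du := smooth_diff sur Bp0; have dc i := smooth_diff (sc i) Bp0.
  rewrite !(derive_sub _ du (dc 0)).
  rewrite !(derive_add _ (smooth_diff sDP Bp0) (smooth_diff sl Bp0)).
  rewrite !(derive_scale _ _ (dc 1)) !derive_coord (HP _ Bp0).2.
  rewrite !mxE !eqxx /= mulr0 addr0 mulr1 subr0.
  have -> : 'D_('e_1) ('D_('e_1) P) p0 + kap =
      - (1 + 'D_('e_1) u p0 * 'D_('e_1) u p0) by rewrite /kap addrA subrr sub0r.
  move: u0; set a := 'D_('e_0) u p0; set b := 'D_('e_1) u p0 => u0.
  have : 0 <= - a * b ^+ 2 by rewrite mulr_ge0 ?sqr_ge0 // oppr_ge0 ltW.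
  rewrite expr2; lra.
split; first by move=> x _; rewrite row2_0.
move=> x Bx w; rewrite row2_0 row2_1.
have dc i := smooth_diff (sc i) Bx.
rewrite (derive_add w (smooth_diff sPq Bx) (smooth_diff sql Bx)).
rewrite (derive_sub w (smooth_diff sP Bx) (smooth_diff (sq 0) Bx)).
rewrite (derive_scale _ w (smooth_diff (sq 1) Bx)).
rewrite (derive_half_sqr w (dc 0)) (derive_half_sqr w (dc 1)) !derive_coord.
rewrite (derive_delta w (smooth_diff sP Bx)) sum_ord2 (HP _ Bx).1; ring.
Qed.

Lemma potential_comp U U' X S Q : smooth_map U X -> smooth_on U' S ->
  (forall x, U x -> U' (X x)) -> potential U' S id Q ->
  potential U (S \o X) X (Q \o X).
Proof.
move=> sX sS UX HS x Ux w.
have dX i : differentiable (fun y => X y 0 i) x by exact: smooth_diff (sX i) Ux.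
have dS := smooth_diff sS (UX _ Ux).
rewrite (derive_comp_delta w dX dS) sum_ord2.
rewrite !(HS _ (UX _ Ux)) /= !derive_coord !mxE !eqxx /=; ring.
Qed.

Lemma potential_sub U U' S P Q : U' `<=` U -> potential U S P Q ->
  potential U' S P Q.
Proof. by move=> UU H x /UU; exact: H. Qed.

Lemma smooth_map_sub U U' X : U' `<=` U -> smooth_map U X -> smooth_map U' X.
Proof. by move=> UU sX i; exact: smooth_sub (sX i). Qed.

(* d(Y.Q - S1 - Q_0^2/2) = Y.dQ + Q.dY - Q.dP - Q_0 dQ_0, and the last three
   terms cancel because Y_0 - P_0 = Q_0 and Y_1 = P_1. *)
Lemma third_potential B S P Q Y : open B -> smooth_on B S -> smooth_map B P ->
  smooth_map B Q -> smooth_map B Y -> potential B S P Q ->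
  (forall x, B x -> Q x 0 0 = Y x 0 0 - P x 0 0) ->
  (forall x, B x -> P x 0 1 = Y x 0 1) ->
  let T x := Y x 0 0 * Q x 0 0 + Y x 0 1 * Q x 0 1 - S x - Q x 0 0 * Q x 0 0 / 2 in
  smooth_on B T /\ potential B T Q Y.
Proof.
move=> oB sS sP sQ sY HS Q0 P1.
have sp i : smooth_on B (fun x => Y x 0 i * Q x 0 i) by exact: smoothM.
have spp : smooth_on B (fun x => Y x 0 0 * Q x 0 0 + Y x 0 1 * Q x 0 1) by exact: smoothD.
have sps : smooth_on B (fun x => Y x 0 0 * Q x 0 0 + Y x 0 1 * Q x 0 1 - S x) by exact: smoothB.
have sq : smooth_on B (fun x => Q x 0 0 * Q x 0 0 / 2).
  by apply: smoothM => //; [exact: smoothM|exact: smooth_cst].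
split; first exact: smoothB.
move=> x Bx w.
have d (f : V -> R) : smooth_on B f -> differentiable f x by move=> sf; exact: smooth_diff sf Bx.
rewrite (derive_sub w (d _ sps) (d _ sq)) (derive_sub w (d _ spp) (d _ sS)).
rewrite (derive_add w (d _ (sp 0)) (d _ (sp 1))).
rewrite (derive_mul w (d _ (sY 0)) (d _ (sQ 0))) (derive_mul w (d _ (sY 1)) (d _ (sQ 1))).
rewrite (derive_half_sqr w (d _ (sQ 0))) (HS _ Bx).
have nB := open_nbhs_nbhs (conj oB Bx).
have E0 : 'D_w (fun y => Q y 0 0) x = 'D_w (fun y => Y y 0 0) x - 'D_w (fun y => P y 0 0) x.
  rewrite -(derive_sub w (d _ (sY 0)) (d _ (sP 0))); apply: near_eq_derive.
  by apply: filterS nB => y; exact: Q0.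
have E1 : 'D_w (fun y => P y 0 1) x = 'D_w (fun y => Y y 0 1) x.
  by apply: near_eq_derive; apply: filterS nB => y; exact: P1.
rewrite E1 E0; ring.
Qed.

End LocalFactorization.

Section LocalPotentials.
Context {R : realType}.
Local Notation V := 'rV[R]_2.
Implicit Types (U B : set V) (X Y F : V -> V) (S : V -> R).

Lemma ball_preimage U X x : open U -> smooth_map U X -> U x ->
  forall W, open W -> W (X x) -> exists r, [/\ 0 < r, ball x r `<=` U &
    forall y, ball x r y -> W (X y)].
Proof.
move=> oU sX Ux W oW Wx.
have cX : {for x, continuous X}.
  apply: differentiable_continuous; apply: differentiable_rV => i.
  exact: smooth_diff (sX i) Ux.
have nW : nbhs (X x) W by exact: open_nbhs_nbhs.
have nU : nbhs x U by exact: open_nbhs_nbhs.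
have /nbhs_ballP[r /= r0 Hr] := @filterI _ _ (nbhs_filter x) _ _ nU (cX _ nW).
by exists r; split=> // y /Hr[].
Qed.

Lemma local_potentials U F x0 : open U -> smooth_map U F -> U x0 ->
  0 < jac F x0 -> exists r (X : nat -> V -> V) (S : nat -> V -> R),
  [/\ 0 < r, ball x0 r `<=` U,
      X 0%N = id /\ (forall k, (3 <= k)%N -> X k = F),
      forall k, smooth_map (ball x0 r) (X k) /\ jac (X k) x0 != 0 &
      forall k, smooth_on (ball x0 r) (S k) /\
        ((k < 3)%N -> potential (ball x0 r) (S k) (X k) (X k.+1))].
Proof.
move=> oU sF Ux0 J0.
have J0' : jac F x0 != 0 by rewrite gt_eqF.
have [r1 [X1 [H [r10 r1U [sX1 sH] J1 [X1E HH]]]]] := first_gradient oU sF Ux0 J0'.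
have ob (x : V) e : open (ball x e) by exact: ball_open.
have bx (x : V) e : 0 < e -> ball x e x by exact: ballxx.
have J1' : jac X1 x0 != 0 by rewrite lt_eqF.
have [r2 [K2 [r20 r2r1 _ IF1]]] := inverse_function_theorem (ob _ _) sX1 (bx _ _ r10) J1'.
have [Y1 [oW sY1 YX1]] := IF1 _ (ob _ _) (fun x Bx => Bx).
set W := X1 @` ball x0 r2 in oW sY1.
have Wp0 : W (X1 x0) by exists x0 => //; exact: bx.
(* The first component of [F] in the coordinates [p = X1 x]; the second one is [p_1]. *)
pose u p := F (Y1 p) 0 0.
have YW p : W p -> ball x0 r2 (Y1 p) by move=> [x Bx <-]; rewrite YX1.
have su : smooth_on W u.
  apply: (@smooth_comp _ _ _ W U (fun x => F x 0 0) Y1) => // p Wp.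
  by apply: r1U; apply: r2r1; exact: YW.
(* In these coordinates [F] is [(u, p_1)], so [jac F] is [D_0 u] times [jac X1]; the opposite signs
   of the two Jacobians decide. *)
have u0 : 'D_('e_0) u (X1 x0) < 0.
  have D j : pd j 0 F x0 = pd j 0 X1 x0 * 'D_('e_0) u (X1 x0) +
      pd j 1 F x0 * 'D_('e_1) u (X1 x0).
    have dX i : differentiable (fun y => X1 y 0 i) x0.
      exact: smooth_diff (sX1 i) (bx _ _ r10).
    have := derive_comp_delta ('e_j) dX (smooth_diff su Wp0).
    rewrite sum_ord2 => E.
    have E1 : pd j 1 F x0 = pd j 1 X1 x0.
      apply: near_eq_derive.
      by apply: filterS (open_nbhs_nbhs (conj (ob _ _) (bx x0 _ r10))) => y /X1E.
    rewrite E1 -E; apply: near_eq_derive.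
    apply: filterS (open_nbhs_nbhs (conj (ob _ _) (bx x0 _ r20))) => y By.
    by rewrite /= /u YX1.
  have : jac F x0 = 'D_('e_0) u (X1 x0) * jac X1 x0.
    have E1 j : pd j 1 X1 x0 = pd j 1 F x0.
      apply: near_eq_derive.
      by apply: filterS (open_nbhs_nbhs (conj (ob _ _) (bx x0 _ r10))) => y /X1E.
    rewrite /jac !E1 (D 0) (D 1); ring.
  move=> E; move: J0; rewrite E; by rewrite nmulr_lgt0.
have [r3 [Q [K [r30 r3W [sQ sK] JQ [QE HK]]]]] := second_gradient oW su Wp0 u0.
have [r4 [r40 r4r1 Hr4]] := ball_preimage (ob _ _) sX1 (bx _ _ r10) (ob _ _) (bx (X1 x0) _ r30).
pose r := Num.min r4 r2.
have r_gt0 : 0 < r by rewrite lt_min r40.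
have rr4 : ball x0 r `<=` ball x0 r4 by apply: le_ball; rewrite ge_min lexx.
have rr2 : ball x0 r `<=` ball x0 r2 by apply: le_ball; rewrite ge_min lexx orbT.
have rr1 : ball x0 r `<=` ball x0 r1 by move=> x /rr4/r4r1.
have rU : ball x0 r `<=` U by move=> x /rr1/r1U.
have X1W x : ball x0 r x -> ball (X1 x0) r3 (X1 x) by move=> /rr4/Hr4.
have sX1r := smooth_map_sub rr1 sX1.
have sX2 := smooth_map_comp (ob _ _) sX1r sQ X1W.
have sFr := smooth_map_sub rU sF.
have pot1 := potential_comp sX1r sK X1W HK.
have sS1 : smooth_on (ball x0 r) (K \o X1) by apply: smooth_comp X1W _ _.
have Q0 x : ball x0 r x -> (Q \o X1) x 0 0 = F x 0 0 - X1 x 0 0.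
  by move=> Bx; rewrite /= (QE _ (X1W _ Bx)) /u YX1 //; exact: rr2.
have P1 x : ball x0 r x -> X1 x 0 1 = F x 0 1 by move=> /rr1/X1E.
have [sT HT] := third_potential (ob _ _) sS1 sX1r sX2 sFr pot1 Q0 P1.
set T := (fun x => _) in sT HT.
have Bx0 := bx x0 _ r_gt0.
(* The default [F] of [nth] supplies the last map and all later ones; [cst 0] keeps the potentials
   smooth for every [k]. *)
exists r, (nth F [:: id; X1; Q \o X1]), (nth (cst 0) [:: H; K \o X1; T]).
split=> //; first by split=> // -[|[|[|[|k]]]].
- move=> [|[|[|k]]] /=; split=> //.
  + by move=> i; exact: smooth_coord.
  + rewrite /jac /pd !derive_coord !mxE !eqxx /= mulr1 mulr0 subr0; exact: oner_neq0.
  + by rewrite (jac_comp sX1r sQ Bx0 (X1W _ Bx0)) mulf_neq0 // gt_eqF.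
  + by rewrite nth_nil.
  + by rewrite nth_nil.
move=> [|[|[|k]]] /=; split=> //.
- exact: smooth_sub sH.
- by move=> _; exact: potential_sub HH.
- by rewrite nth_nil; exact: smooth_cst.
Qed.

End LocalPotentials.

(** * Periscopes *)

Section LocalPeriscope.
Context {R : realType}.
Local Notation V := 'rV[R]_2.
Implicit Types (U B : set V) (F : V -> V) (X : nat -> V -> V).

Definition half_sq (x : V) : R := x 0 0 * x 0 0 / 2 + x 0 1 * x 0 1 / 2.

(* With p = X k, q = X k.+1 and dS = q . dp, the heights S - |p|^2/2 and
   |q|^2/2 - q . p + S have differentials (q - p) . dp and (q - p) . dq. *)
Definition height X (S : nat -> V -> R) (a : nat) (x : V) : R :=
  let p := X a./2 x in let q := X a./2.+1 x in
  if odd a then half_sq q - (q 0 0 * p 0 0 + q 0 1 * p 0 1) + S a./2 x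
  else S a./2 x - half_sq p.

Lemma smooth_half_sq B (P : V -> V) : open B -> smooth_map B P ->
  smooth_on B (fun x => half_sq (P x)).
Proof.
move=> oB sP; have sq i : smooth_on B (fun x => P x 0 i * P x 0 i / 2).
  by apply: smoothM => //; [exact: smoothM|exact: smooth_cst].
exact: smoothD.
Qed.

Lemma derive_half_sq B (P : V -> V) x w : open B -> smooth_map B P -> B x ->
  'D_w (fun x => half_sq (P x)) x = P x 0 0 * 'D_w (fun y => P y 0 0) x +
     P x 0 1 * 'D_w (fun y => P y 0 1) x.
Proof.
move=> oB sP Bx.
have sq i : smooth_on B (fun x => P x 0 i * P x 0 i / 2).
  by apply: smoothM => //; [exact: smoothM|exact: smooth_cst].
rewrite (derive_add w (smooth_diff (sq 0) Bx) (smooth_diff (sq 1) Bx)).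
by rewrite (derive_half_sqr w (smooth_diff (sP 0) Bx)) (derive_half_sqr w (smooth_diff (sP 1) Bx)).
Qed.

Lemma smooth_height B X S a : open B -> (forall k, smooth_map B (X k)) ->
  (forall k, smooth_on B (S k)) -> smooth_on B (height X S a).
Proof.
move=> oB sX sS; rewrite /height; case: odd.
  apply: smoothD => //; apply: smoothB => //; first exact: smooth_half_sq.
  by apply: smoothD => //; apply: smoothM => //; exact: sX.
by apply: smoothB => //; exact: smooth_half_sq.
Qed.

Lemma potential_height B X S a : open B -> (forall k, smooth_map B (X k)) ->
  (forall k, smooth_on B (S k)) ->
  potential B (S a./2) (X a./2) (X a./2.+1) ->
  potential B (height X S a) (X (uphalf a)) (fun x => X a./2.+1 x - X a./2 x).
Proof.
move=> oB sX sS pot x Bx w.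
have d (f : V -> R) : smooth_on B f -> differentiable f x.
  by move=> sf; exact: smooth_diff sf Bx.
rewrite /height uphalf_half; case: odd => /=; rewrite ?add1n ?add0n.
  set p := X a./2 in pot *; set q := X a./2.+1 in pot *.
  have sp : smooth_map B p by exact: sX.
  have sq : smooth_map B q by exact: sX.
  have sm i : smooth_on B (fun x => q x 0 i * p x 0 i) by exact: smoothM.
  have smm : smooth_on B (fun x => q x 0 0 * p x 0 0 + q x 0 1 * p x 0 1).
    exact: smoothD.
  have sh := smooth_half_sq oB sq.
  rewrite (derive_add w (d _ (smoothB oB sh smm)) (d _ (sS _))).
  rewrite (derive_sub w (d _ sh) (d _ smm)) (derive_half_sq w oB sq Bx).
  rewrite (derive_add w (d _ (sm 0)) (d _ (sm 1))) (pot _ Bx).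
  rewrite (derive_mul w (d _ (sq 0)) (d _ (sp 0))) (derive_mul w (d _ (sq 1)) (d _ (sp 1))).
  rewrite !mxE; ring.
rewrite (derive_sub w (d _ (sS _)) (d _ (smooth_half_sq oB (sX _)))).
rewrite (derive_half_sq w oB (sX _) Bx) (pot _ Bx) !mxE; ring.
Qed.

(** Stage [k] leads from [X k] to [X k.+1] by the mirrors [k.*2] and [k.*2.+1]; thus mirror [a]
    belongs to stage [a./2] and stands over [X (uphalf a) x]. The gap makes the reflected ray arrive
    at the second mirror; the Lipschitz bound, in terms of the point below the mirror, will exclude
    repeated hits. *)
Record periscope B F X (E : nat -> V -> R) (C : R) : Prop := Periscope {
  periscope_first : X 0%N = id;
  periscope_last : X 3 = F;
  periscope_embedding : forall k, exists Y, embedding_on B (X k) Y;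
  periscope_smooth_map : forall k, smooth_map B (X k);
  periscope_smooth : forall a, smooth_on B (E a);
  periscope_derive : forall a, (a < 6)%N ->
    potential B (E a) (X (uphalf a)) (fun x => X a./2.+1 x - X a./2 x);
  periscope_gap : forall k x,
    E k.*2.+1 x - E k.*2 x = half_sq (X k.+1 x - X k x);
  periscope_bound : forall k x, (k < 6)%N -> B x -> `|X k x| <= C;
  periscope_height_bound : forall a x, (a < 6)%N -> B x -> `|E a x| <= C;
  periscope_lipschitz : forall a x y, (a < 6)%N -> B x -> B y ->
    `|E a x - E a y| <= C * `|X (uphalf a) x - X (uphalf a) y| }.

Lemma common_radius (N : nat) (P : nat -> R -> R -> Prop) :
  (forall i r r' C C', 0 < r' -> r' <= r -> C <= C' -> P i r C -> P i r' C') ->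
  (forall i, exists r C, 0 < r /\ P i r C) ->
  exists r C, [/\ 0 < r, 0 <= C & forall i, (i < N)%N -> P i r C].
Proof.
move=> mono ex; elim: N => [|N [r [C [r0 C0 IH]]]]; first by exists 1, 0.
have [r' [C' [r'0 HP]]] := ex N.
have m0 : 0 < Num.min r r' by rewrite lt_min r0.
exists (Num.min r r'), (Num.max C C'); split=> //; first by rewrite le_max C0.
move=> i; rewrite ltnS leq_eqVlt => /predU1P[->|/IH HPi].
  by apply: mono HP => //; [rewrite ge_min lexx orbT|rewrite le_max lexx orbT].
by apply: mono HPi => //; [rewrite ge_min lexx|rewrite le_max lexx].
Qed.

Theorem local_periscope U F x0 : open U -> smooth_map U F -> U x0 ->
  0 < jac F x0 -> exists r X E C,
    [/\ 0 < r, ball x0 r `<=` U, 0 <= C & periscope (ball x0 r) F X E C].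
Proof.
move=> oU sF Ux0 J0.
have [r0 [X [S [r00 r0U [X0 X3] HX HS]]]] := local_potentials oU sF Ux0 J0.
have oB (r : R) : open (ball x0 r) by exact: ball_open.
have Bx0 : ball x0 r0 x0 by exact: ballxx.
have sX k : smooth_map (ball x0 r0) (X k) by case: (HX k).
have sS k : smooth_on (ball x0 r0) (S k) by case: (HS k).
pose E := height X S.
have sE a : smooth_on (ball x0 r0) (E a) by exact: smooth_height.
pose P i r C := [/\ ball x0 r `<=` ball x0 r0,
  (forall B, open B -> B `<=` ball x0 r -> exists Y, embedding_on B (X i) Y),
  (forall y z, ball x0 r y -> ball x0 r z -> `|z - y| <= C * `|X i z - X i y|),
  (forall y z, ball x0 r y -> ball x0 r z -> `|E i z - E i y| <= C * `|z - y|) &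
  forall y, ball x0 r y -> `|E i y| <= C /\ `|X i y| <= C].
have mono i r r' C C' : 0 < r' -> r' <= r -> C <= C' -> P i r C -> P i r' C'.
  move=> r'0 rr CC; have sub : ball x0 r' `<=` ball x0 r by exact: le_ball.
  have le z : C * `|z : V| <= C' * `|z| by exact: ler_wpM2r.
  case=> H1 H2 H3 H4 H5; split.
  - by move=> x /sub/H1.
  - by move=> B oB' BB; apply: H2 => // x /BB/sub.
  - by move=> y z /sub By /sub Bz; exact: le_trans (H3 _ _ By Bz) _.
  - by move=> y z /sub By /sub Bz; exact: le_trans (H4 _ _ By Bz) _.
  - by move=> y /sub/H5[h1 h2]; split; exact: le_trans CC.
have exP i : exists r C, 0 < r /\ P i r C.
  have [_ Ji] := HX i.
  have [r1 [K1 [r10 r1s H1 IF]]] := inverse_function_theorem (oB r0) (sX i) Bx0 Ji.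
  have [K2 [r2 [K20 r20 H2]]] := lipschitz_ball (oB r0) (sE i) Bx0.
  have [K3 [r3 [K30 r30 H3]]] := continuous_ball_bounded (oB r0) (sE i) Bx0.
  have [K4 [r4 [K40 r40 H4]]] := continuous_ball_bounded (oB r0) (sX i 0) Bx0.
  have [K5 [r5 [K50 r50 H5]]] := continuous_ball_bounded (oB r0) (sX i 1) Bx0.
  pose r := Num.min r1 (Num.min (Num.min r2 r3) (Num.min r4 r5)).
  pose K := Num.max K1 (Num.max (Num.max K2 K3) (Num.max K4 K5)).
  have r_gt0 : 0 < r by rewrite !lt_min r10 r20 r30 r40.
  exists r, K; split=> //.
  have L1 : ball x0 r `<=` ball x0 r1 by apply: le_ball; rewrite !ge_min lexx.
  have L2 : ball x0 r `<=` ball x0 r2 by apply: le_ball; rewrite !ge_min lexx ?orbT.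
  have L3 : ball x0 r `<=` ball x0 r3 by apply: le_ball; rewrite !ge_min lexx ?orbT.
  have L4 : ball x0 r `<=` ball x0 r4 by apply: le_ball; rewrite !ge_min lexx ?orbT.
  have L5 : ball x0 r `<=` ball x0 r5 by apply: le_ball; rewrite !ge_min lexx ?orbT.
  split.
  - by move=> x /L1/r1s.
  - by move=> B oB' BB; apply: IF => // x /BB/L1.
  - move=> y z /L1 By /L1 Bz; apply: le_trans (H1 _ _ By Bz) _.
    by apply: ler_wpM2r => //; rewrite !le_max lexx.
  - move=> y z /L2 By /L2 Bz; apply: le_trans (H2 _ _ By Bz) _.
    by apply: ler_wpM2r => //; rewrite !le_max lexx ?orbT.
  - move=> y By; split.
      by apply: le_trans (H3 _ (L3 _ By)) _; rewrite !le_max lexx ?orbT.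
    apply: norm_le_coord; first by rewrite !le_max K20 ?orbT.
    apply: forall_ord2.
      by apply: le_trans (H4 _ (L4 _ By)) _; rewrite !le_max lexx ?orbT.
    by apply: le_trans (H5 _ (L5 _ By)) _; rewrite !le_max lexx ?orbT.
have [r [C [r_gt0 C0 HP]]] := common_radius 6 mono exP.
have rr0 : ball x0 r `<=` ball x0 r0 by case: (HP 0%N isT).
have le1 a : (a < 6)%N -> (uphalf a < 6)%N.
  by case: a => [|[|[|[|[|[|]]]]]].
(* The height is [C]-Lipschitz in [x], and [x] is [C]-Lipschitz in the point below the mirror;
   composing gives [C * C]. *)
have C1 : C <= Num.max C (C * C) by rewrite le_max lexx.
have C2 : C * C <= Num.max C (C * C) by rewrite le_max lexx orbT.
exists r, X, E, (Num.max C (C * C)); split=> //; first by move=> x /rr0/r0U.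
  by rewrite le_max C0.
split=> //.
- exact: X3.
- move=> k; case: (ltnP k 6) => k6.
    by have [_ + _ _ _] := HP _ k6; apply.
  have [_ + _ _ _] := HP 3 isT; rewrite !X3 //; last exact: leq_trans k6.
  by apply.
- by move=> k; exact: smooth_map_sub rr0 (sX k).
- by move=> a; exact: smooth_sub rr0 (sE a).
- move=> a a6; apply: potential_height => //.
  + by move=> k; exact: smooth_map_sub rr0 (sX k).
  + by move=> k; exact: smooth_sub rr0 (sS k).
  apply: (potential_sub rr0); apply: (HS _).2.
  by move: a a6 => [|[|[|[|[|[|]]]]]].
- move=> k x; rewrite /E /height /= odd_double /= doubleK uphalf_double.
  by rewrite /half_sq !mxE; field.
- move=> k x k6 Bx; have [_ _ _ _ /(_ _ Bx)[_]] := HP _ k6.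
  by move=> /le_trans; apply.
- move=> k x k6 Bx; have [_ _ _ _ /(_ _ Bx)[+ _]] := HP _ k6.
  by move=> /le_trans; apply.
move=> a x y a6 Bx By.
have [_ _ _ H1 _] := HP _ a6.
have [_ _ H2 _ _] := HP _ (le1 _ a6).
apply: le_trans (H1 _ _ By Bx) _.
apply: le_trans (ler_wpM2l C0 (H2 _ _ By Bx)) _.
by rewrite mulrA; apply: ler_wpM2r.
Qed.

End LocalPeriscope.

(** * Graphs as mirrors *)

Section GraphSurface.
Context {R : realType}.
Local Notation V := 'rV[R]_2.
Local Notation V3 := 'rV[R]_3.

Definition hor (q : V3) : V := row2 (q 0 0) (q 0 1).

Lemma point3_0 (x : V) z : point3 x z 0 0 = x 0 0.
Proof.
rewrite /point3 -[LHS]/((row_mx x (const_mx z : 'rV_1)) 0 (0 : 'I_(2 + 1))).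
by rewrite (_ : (0 : 'I_(2 + 1)) = lshift 1 0) ?row_mxEl //; exact: val_inj.
Qed.

Lemma point3_1 (x : V) z : point3 x z 0 1 = x 0 1.
Proof.
rewrite /point3 -[LHS]/((row_mx x (const_mx z : 'rV_1)) 0 (1 : 'I_(2 + 1))).
by rewrite (_ : (1 : 'I_(2 + 1)) = lshift 1 1) ?row_mxEl //; exact: val_inj.
Qed.

Lemma point3_2 (x : V) z : point3 x z 0 2 = z.
Proof.
rewrite /point3 -[LHS]/((row_mx x (const_mx z : 'rV_1)) 0 (2 : 'I_(2 + 1))).
rewrite (_ : (2 : 'I_(2 + 1)) = rshift 2 0) ?row_mxEr ?mxE //; exact: val_inj.
Qed.

Lemma forall_ord3 (P : 'I_3 -> Prop) : P 0 -> P 1 -> P 2 -> forall i, P i.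
Proof.
move=> P0 P1 P2 [[|[|[|//]]] ilt].
- by have -> : Ordinal ilt = 0 by exact: val_inj.
- by have -> : Ordinal ilt = 1 by exact: val_inj.
- by have -> : Ordinal ilt = 2 by exact: val_inj.
Qed.

Lemma hor_point3 (x : V) z : hor (point3 x z) = x.
Proof. by apply: row2P; rewrite ?row2_0 ?row2_1 ?point3_0 ?point3_1. Qed.

Lemma point3_hor (q : V3) : point3 (hor q) (q 0 2) = q.
Proof.
apply/rowP; apply: forall_ord3.
- by rewrite point3_0 row2_0.
- by rewrite point3_1 row2_1.
- by rewrite point3_2.
Qed.

Lemma dot3 (u v : V3) : dot u v = u 0 0 * v 0 0 + u 0 1 * v 0 1 + u 0 2 * v 0 2.
Proof.
rewrite /dot !big_ord_recl big_ord0 addr0 addrA.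
rewrite (_ : lift ord0 ord0 = 1); last exact: val_inj.
by rewrite (_ : lift ord0 (lift ord0 ord0) = 2); last exact: val_inj.
Qed.

Lemma derive_comp_dir n (W : normedModType R) (g : 'rV[R]_n -> R)
    (F : W -> 'rV[R]_n) x v :
  differentiable F x -> differentiable g (F x) ->
  'D_v (g \o F) x = 'D_('D_v F x) g (F x).
Proof.
move=> dF dg; rewrite deriveE; last exact: differentiable_comp.
by rewrite diff_comp //= !deriveE.
Qed.

(** Parametrized by the starting point [x] of the ray; for an embedding [X] it is a graph over the
    translated image of [X]. *)
Definition graph_surface (P : set V) (X : V -> V) (T : V) (phi : V -> R) : set V3 :=
  (fun x => point3 (X x + T) (phi x)) @` P.

Section Graph.
Variables (B : set V) (X Y : V -> V) (T : V) (phi : V -> R).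
Hypotheses (oB : open B) (sX : smooth_map B X) (eXY : embedding_on B X Y).
Hypothesis sphi : smooth_on B phi.

(** Over the open cylinder [U] the surface is the zero set of [g], the height above the graph of
    [psi]; its vertical derivative is [1], so it is regular. *)
Let h (q : V3) : V := hor q - T.
Let U : set V3 := h @^-1` (X @` B).
Let psi (y : V) : R := phi (Y y).
Let g (q : V3) : R := q 0 2 - psi (h q).

Let smooth_h i : smooth_on setT (fun q => h q 0 i).
Proof.
have H (j : 'I_3) (a : R) : smooth_on setT (fun q : V3 => q 0 j - a).
  by apply: smoothB; [exact: openT|exact: smooth_coord|exact: smooth_cst].
move: i; apply: forall_ord2.
  by apply: smooth_eq (H 0 (T 0 0)); [exact: openT|move=> q _; rewrite !mxE].
by apply: smooth_eq (H 1 (T 0 1)); [exact: openT|move=> q _; rewrite !mxE].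
Qed.

Let differentiable_h q : differentiable h q.
Proof. by apply: differentiable_rV => i; exact: smooth_diff (smooth_h i) I. Qed.

Let derive_h q w : 'D_w h q = hor w.
Proof.
apply/rowP => i; rewrite derive_rV //.
have H (j : 'I_3) (a : R) : 'D_w (fun q : V3 => q 0 j - a) q = w 0 j.
  rewrite derive_sub ?derive_cst ?subr0 ?derive_coord //.
  exact: differentiable_coord.
move: i; apply: forall_ord2.
  rewrite mxE /= -(H 0 (T 0 0)); congr ('D_w _ q); apply/funext => z.
  by rewrite !mxE.
rewrite mxE /= -(H 1 (T 0 1)); congr ('D_w _ q); apply/funext => z.
by rewrite !mxE.
Qed.

Let oXB : open (X @` B). Proof. by case: eXY. Qed.

Let YB y : (X @` B) y -> B (Y y).
Proof. by case: eXY => _ _ YX [x Bx <-]; rewrite YX. Qed.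

Let smooth_psi : smooth_on (X @` B) psi.
Proof.
apply: (@smooth_comp _ _ _ (X @` B) B phi Y) => //.
by case: eXY.
Qed.

Let open_U : open U.
Proof. by apply: open_comp => // q _; exact: differentiable_continuous. Qed.

Let smooth_psi_h : smooth_on U (psi \o h).
Proof.
apply: (@smooth_comp _ _ _ U (X @` B) psi h) => // i.
exact: smooth_sub (smooth_h i).
Qed.

Let smooth_g : smooth_on U g.
Proof. by apply: smoothB => //; exact: smooth_coord. Qed.

Let g_zero q : U q -> graph_surface B X T phi q <-> g q = 0.
Proof.
have [_ _ YX] := eXY.
move=> Uq; split.
  move=> [x Bx <-]; rewrite /g point3_2 /psi /h hor_point3 addrK YX //.
  exact: subrr.
case: Uq => x Bx xE /eqP; rewrite subr_eq0 => /eqP q2.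
exists x => //; rewrite -[RHS]point3_hor q2 /psi -xE YX //.
by rewrite xE /h subrK.
Qed.

Let derive_g q w : U q -> 'D_w g q = w 0 2 - 'D_(hor w) psi (h q).
Proof.
move=> Uq; rewrite derive_sub.
- by rewrite derive_coord (@derive_comp_dir _ _ psi h) ?derive_h //; exact: smooth_diff smooth_psi Uq.
- exact: differentiable_coord.
- exact: smooth_diff smooth_psi_h Uq.
Qed.

Let graph_U q : graph_surface B X T phi q -> U q.
Proof. by move=> [x Bx <-]; exists x => //; rewrite /h hor_point3 addrK. Qed.

Lemma smooth_surface_graph : smooth_surface (graph_surface B X T phi).
Proof.
move=> p Sp; exists U, g; split=> //; first exact: graph_U.
exists 'e_2; rewrite derive_g; last exact: graph_U.
have -> : hor 'e_2 = 0 by apply: row2P; rewrite ?row2_0 ?row2_1 !mxE.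
by rewrite derive0 subr0 !mxE !eqxx oner_neq0.
Qed.

(** [psi] is [phi] as a function of the point below the mirror, so [dphi = N . dX] says that [N] is
    its gradient. *)
Lemma derive_psi (N : V -> V) x v : potential B phi X N -> B x ->
  'D_v psi (X x) = N x 0 0 * v 0 0 + N x 0 1 * v 0 1.
Proof.
move=> pot Bx; have [_ sY YX] := eXY.
have XBx : (X @` B) (X x) by exists x.
have dY : differentiable Y (X x).
  by apply: differentiable_rV => i; exact: smooth_diff (sY i) XBx.
have dphi : differentiable phi (Y (X x)) by rewrite YX //; exact: smooth_diff sphi Bx.
rewrite (@derive_comp_dir _ _ phi Y) // YX // (pot _ Bx).
have D i : 'D_('D_v Y (X x)) (fun y => X y 0 i) x = v 0 i.
  have dXi : differentiable (fun y => X y 0 i) (Y (X x)).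
    by rewrite YX //; exact: smooth_diff (sX i) Bx.
  have := @derive_comp_dir _ _ (fun y => X y 0 i) Y (X x) v dY dXi.
  rewrite YX // => <-; rewrite -[RHS](derive_coord (X x)); apply: near_eq_derive.
  apply: filterS (open_nbhs_nbhs (conj oXB XBx)) => y [z Bz <-] /=.
  by rewrite YX.
by rewrite !D.
Qed.

Lemma normal_vector_graph (N : V -> V) x : potential B phi X N -> B x ->
  normal_vector (graph_surface B X T phi) (point3 (X x + T) (phi x))
    (point3 (N x) (-1)).
Proof.
move=> pot Bx; split.
  apply/eqP => /rowP/(_ 2); rewrite point3_2 mxE => /eqP.
  by rewrite oppr_eq0 oner_eq0.
move=> w [c [c0 Sc dc]].
set p := point3 _ _ in c0.
have Up : U p by apply: graph_U; exists x.
have dgp : differentiable g (c 0) by rewrite c0; exact: smooth_diff smooth_g Up.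
have dc0 : differentiable c 0 by apply/derivable1_diffP; case: dc.
have : 'D_1 (g \o c) 0 = 0.
  rewrite -[RHS](derive_cst (0 : R) (0 : R) (1 : R)); apply: near_eq_derive.
  apply: filterS Sc => s Ss /=; apply/g_zero => //; exact: graph_U.
rewrite derive_comp_dir // c0.
have -> : 'D_1 c 0 = w by case: dc.
rewrite derive_g // /h hor_point3 addrK (derive_psi _ pot Bx) => E.
rewrite dot3 point3_0 point3_1 point3_2 mulN1r.
by move: E; rewrite row2_0 row2_1 => /eqP; rewrite subr_eq0 => /eqP ->; rewrite subrr.
Qed.

End Graph.
End GraphSurface.

(** * Motion along a polygon *)

Section Motion.
Context {R : realType}.
Local Notation V := 'rV[R]_2.
Local Notation V3 := 'rV[R]_3.

Section Polygon.
Variables (K : nat) (t : nat -> R) (v : nat -> V3) (p : nat -> V3).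
Hypothesis t_incr : forall i, (i.+1 < K)%N -> t i < t i.+1.
Hypothesis p_step : forall i, (i.+1 < K)%N ->
  p i.+1 = p i + (t i.+1 - t i) *: v i.+1.

(** A leg is anchored at its initial vertex; leg [0] has none and is anchored at vertex [0], because
    [0.-1 = 0]. *)
Definition leg_line (i : nat) (s : R) : V3 := p i.-1 + (s - t i.-1) *: v i.

(** When all reflections are past, [find] returns [K], the index of the last leg. *)
Definition polygon (s : R) : V3 :=
  leg_line (find (fun i => s <= t i) (iota 0 K)) s.

Lemma time_lt i j : (i < j)%N -> (j < K)%N -> t i < t j.
Proof.
elim: j => // j IH; rewrite ltnS leq_eqVlt => /predU1P[->|ij] jK; first exact: t_incr.
by apply: lt_trans (IH ij (ltnW jK)) _; exact: t_incr.
Qed.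

Lemma leg_line_end i : (i < K)%N -> leg_line i (t i) = p i.
Proof.
by case: i => [|i] iK; rewrite /leg_line /= ?subrr ?scale0r ?addr0 // -p_step.
Qed.

Lemma leg_line_start i : leg_line i.+1 (t i) = p i.
Proof. by rewrite /leg_line /= subrr scale0r addr0. Qed.

Lemma find_time s : let m := find (fun i => s <= t i) (iota 0 K) in
  [/\ (m <= K)%N, forall j, (j < m)%N -> t j < s & (m < K)%N -> s <= t m].
Proof.
set m := find _ _ => /=.
have mK : (m <= K)%N by rewrite -[leqRHS](size_iota 0 K) find_size.
split=> // [j jm|mK'].
  have := before_find 0%N jm; rewrite nth_iota ?(leq_trans jm) // add0n.
  by move/negbT; rewrite -ltNge.
have := @nth_find _ 0%N (fun i => s <= t i) (iota 0 K).
by rewrite has_find size_iota -/m => /(_ mK'); rewrite nth_iota // add0n.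
Qed.

(** At a reflection time two closed legs contain [s] and [find] selects the earlier; the two lines
    meet there in the common vertex. *)
Lemma polygon_leg i s : (i <= K)%N -> leg (fun j : 'I_K => t j) i s ->
  polygon s = leg_line i s.
Proof.
move=> iK [H1 H2]; rewrite /polygon; have := find_time s.
move: (find _ _) => m [mK M1 M2].
have [mi|im|->//] := ltngtP m i.
  have mK' : (m < K)%N by exact: leq_trans iK.
  have sm : s = t m.
    by apply/eqP; rewrite eq_le (M2 mK') (H1 (Ordinal mK')).
  have : (m.+1 == i)%N.
    rewrite eqn_leq mi leqNgt; apply/negP => mi'.
    have m1K : (m.+1 < K)%N by exact: leq_trans mi' iK.
    have := H1 (Ordinal m1K) mi'; rewrite /= sm leNgt => /negP; apply.
    exact: t_incr.
  by move=> /eqP <-; rewrite sm leg_line_start leg_line_end.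
have iK' : (i < K)%N by exact: leq_trans im mK.
have := M1 _ im; rewrite ltNge => /negP[].
exact: (H2 (Ordinal iK')).
Qed.

Lemma leg_exists s : exists2 i, (i <= K)%N & leg (fun j : 'I_K => t j) i s.
Proof.
have := find_time s; move: (find _ _) => m [mK M1 M2]; exists m => //; split=> j jm.
  by apply: ltW; exact: M1.
have mK' : (m < K)%N by exact: leq_ltn_trans jm (ltn_ord j).
apply: le_trans (M2 mK') _.
by move: jm; rewrite leq_eqVlt => /predU1P[->//|jm]; apply: ltW; exact: time_lt.
Qed.

Lemma leg_time a : (a < K)%N -> leg (fun j : 'I_K => t j) a (t a).
Proof.
move=> aK; split=> j ja; first by apply: ltW; exact: time_lt.
by move: ja; rewrite leq_eqVlt => /predU1P[->//|ja]; apply: ltW; exact: time_lt.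
Qed.

Lemma polygon_vertex a : (a < K)%N -> polygon (t a) = p a.
Proof.
by move=> aK; rewrite (polygon_leg (ltnW aK) (leg_time aK)) leg_line_end.
Qed.

Theorem polygon_motion N (M : 'I_N -> mirror R) :
  (forall i, (i <= K)%N -> dot (v i) (v i) = 1) ->
  (forall i s m, (i <= K)%N -> leg (fun j : 'I_K => t j) i s ->
     mirror_set (M m) (leg_line i s) -> exists2 j, (j < K)%N & s = t j) ->
  (forall j, (j < K)%N -> exists m, mirror_set (M m) (p j)) ->
  (forall j m, (j < K)%N -> mirror_set (M m) (p j) -> exists nu,
     [/\ normal_vector (mirror_surface (M m)) (p j) nu, dot (v j) nu != 0 &
         v j.+1 = reflect_velocity nu (v j)]) ->
  billiard_motion M (fun j : 'I_K => t j) v polygon.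
Proof.
move=> unit_v hits on_mirror refl; split=> //.
- by move=> i j ij; exact: time_lt.
- move=> i iK s s' ls ls'; rewrite !(polygon_leg iK) // /leg_line -addrA -scalerDl.
  by congr (_ + _ *: _); ring.
- move=> s; split.
    move=> [m]; have [i iK li] := leg_exists s.
    rewrite (polygon_leg iK li) => /(hits _ _ _ iK li)[j jK ->].
    by exists (Ordinal jK).
  by move=> [j ->]; rewrite polygon_vertex //; exact: on_mirror.
move=> j m; rewrite polygon_vertex // => /(refl _ _ (ltn_ord j)); exact.
Qed.

End Polygon.

Definition upward : V3 := point3 0 1.

Lemma upwardE : (upward 0 0 = 0) * (upward 0 1 = 0) * (upward 0 2 = 1).
Proof. by rewrite /upward point3_0 point3_1 point3_2 !mxE. Qed.

Lemma dot_upward : dot upward upward = 1.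
Proof. by rewrite dot3 !upwardE !mulr0 !add0r mulr1. Qed.

Lemma reflect_velocityE (nu w : V3) i :
  reflect_velocity nu w 0 i = w 0 i - 2 * dot w nu / dot nu nu * nu 0 i.
Proof. by rewrite !mxE. Qed.

(* For light entering vertically, a mirror with slope D / c redirects it along
   (D, (|D|^2 - c^2) / 2c), a vector of length (|D|^2 + c^2) / 2c. *)
Section Reflection.
Variables (D : V) (c : R).
Hypothesis c0 : 0 < c.

Definition sq_norm : R := D 0 0 * D 0 0 + D 0 1 * D 0 1.
Definition leg_length : R := (sq_norm + c * c) / (2 * c).
Definition leg_rise : R := (sq_norm - c * c) / (2 * c).
Definition leg_velocity : V3 := leg_length^-1 *: point3 D leg_rise.
Definition mirror_normal : V3 := point3 (c^-1 *: D) (-1).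

Lemma sq_norm_ge0 : 0 <= sq_norm.
Proof. by rewrite addr_ge0 // -expr2 sqr_ge0. Qed.

Lemma leg_length_gt0 : 0 < leg_length.
Proof. by rewrite divr_gt0 ?mulr_gt0 // ltr_wpDl ?sq_norm_ge0 // mulr_gt0. Qed.

Let c_neq0 : c != 0. Proof. by rewrite gt_eqF. Qed.

Let scc_neq0 : sq_norm + c * c != 0.
Proof. by rewrite gt_eqF // ltr_wpDl ?sq_norm_ge0 // mulr_gt0. Qed.

Lemma leg_lengthK : leg_length *: leg_velocity = point3 D leg_rise.
Proof. by rewrite scalerA mulfV ?scale1r // gt_eqF // leg_length_gt0. Qed.

Lemma leg_velocityE : (leg_velocity 0 0 = leg_length^-1 * D 0 0) *
  (leg_velocity 0 1 = leg_length^-1 * D 0 1) *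
  (leg_velocity 0 2 = leg_length^-1 * leg_rise).
Proof. by do !split; rewrite [LHS]mxE ?point3_0 ?point3_1 ?point3_2. Qed.

Lemma mirror_normalE : (mirror_normal 0 0 = D 0 0 / c) *
  (mirror_normal 0 1 = D 0 1 / c) * (mirror_normal 0 2 = -1).
Proof. by do !split; rewrite ?point3_0 ?point3_1 ?point3_2 // mxE mulrC. Qed.

Lemma dot_leg_velocity : dot leg_velocity leg_velocity = 1.
Proof.
rewrite dot3 !leg_velocityE /leg_rise /leg_length.
move: scc_neq0; rewrite /sq_norm => h; field; by rewrite c_neq0 h.
Qed.

Lemma reflect_upward : reflect_velocity mirror_normal upward = leg_velocity.
Proof.
have h := scc_neq0; rewrite /sq_norm in h.
apply/rowP; apply: forall_ord3; rewrite reflect_velocityE !dot3 !leg_velocityE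
  !mirror_normalE !upwardE /leg_rise /leg_length /sq_norm; field;
  by rewrite c_neq0 h.
Qed.

Lemma reflect_leg_velocity : reflect_velocity mirror_normal leg_velocity = upward.
Proof.
have h := scc_neq0; rewrite /sq_norm in h.
apply/rowP; apply: forall_ord3; rewrite reflect_velocityE !dot3 !leg_velocityE
  !mirror_normalE !upwardE /leg_rise /leg_length /sq_norm; field;
  by rewrite c_neq0 h.
Qed.

Lemma dot_upward_normal : dot upward mirror_normal != 0.
Proof.
by rewrite dot3 !mirror_normalE !upwardE !mul0r !add0r mul1r oppr_eq0 oner_neq0.
Qed.

Lemma dot_leg_velocity_normal : dot leg_velocity mirror_normal != 0.
Proof.
have -> : dot leg_velocity mirror_normal = 1; last exact: oner_neq0.
rewrite dot3 !leg_velocityE !mirror_normalE /leg_rise /leg_length.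
move: scc_neq0; rewrite /sq_norm => h; field; by rewrite c_neq0 h.
Qed.

End Reflection.
End Motion.

(** * Independent beams *)

Section Configuration.
Context {R : realType}.
Local Notation V := 'rV[R]_2.
Variables (N : nat) (B P : 'I_N -> set V) (F : 'I_N -> V -> V).
Variables (X : 'I_N -> nat -> V -> V) (E : 'I_N -> nat -> V -> R) (C : R).
Variable f : V -> V.
Hypothesis C0 : 0 <= C.
Hypothesis oB : forall i, open (B i).
Hypothesis PB : forall i, P i `<=` B i.
Hypothesis per : forall i, periscope (B i) (F i) (X i) (E i) C.
Hypothesis P_disj : forall i j x, P i x -> P j x -> i = j.
Hypothesis Ff : forall i x, P i x -> F i x = f x.
Hypothesis f_inj : forall i j x y, P i x -> P j y -> f x = f y -> x = y.

(* Horizontal position, in units of [slot_width], of the k-th vertical segment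
   of the i-th beam: distinct beams only share slot 0, before their first and
   after their last mirror, where they are kept apart by injectivity. *)
Definition slot (i : 'I_N) (k : nat) : nat :=
  match k with 0 => 0 | 1 => i.*2.+1 | 2 => i.*2.+2 | _ => 0 end.

(** Any width above [2 * C] separates the slots, as positions are bounded by [C]. The factor 4 also
    serves [self_hit], which needs [c^2 > C c + 6 C^2] for every gap [c]. *)
Definition slot_width : R := 4 * (C + 1).
Local Notation L := slot_width.
Definition offset i k : R := L * (slot i k)%:R.
Definition shift i k : R := offset i k.+1 - offset i k.
Definition gap i k : R := `|shift i k|.
(* The levels of mirrors with distinct (stage, beam) lie in disjoint slabs. *)
Definition slab_height : R := 2 * C + 3.
(** Numbered stage by stage, so that all mirrors of one stage lie below those of the next, whatever
    the beams. *)
Definition slab (i : 'I_N) (k : nat) : nat := (k * N + i)%N.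

Definition track i k x : V := X i k x + row2 (offset i k) 0.
Definition track_gap i k x : V := track i k.+1 x - track i k x.
(** The last term is the potential of the translation by [shift]: the gradient in the point below
    the mirror becomes [track_gap] divided by [gap], the slope of [mirror_normal]. *)
Definition level i a x : R := (slab i a./2)%:R * slab_height +
  E i a x / gap i a./2 + shift i a./2 / gap i a./2 * X i (uphalf a) x 0 0.
Definition vertex x i a : 'rV[R]_3 := point3 (track i (uphalf a) x) (level i a x).

Let L0 : 0 < L. Proof. by rewrite /L; move: C0; lra. Qed.

Lemma gap_ge i k : (k < 3)%N -> L <= gap i k.
Proof.
move=> k3; rewrite /gap /shift /offset -mulrBr normrM (gtr0_norm L0) -[leLHS]mulr1.
rewrite ler_pM2l //; case: k k3 => [|[|[|//]]] _ /=.
- by rewrite subr0 normr_nat ler1n.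
- by rewrite -natrB // subSn // subnn normr1.
- by rewrite sub0r normrN normr_nat ler1n.
Qed.

Lemma gap_gt0 i k : (k < 3)%N -> 0 < gap i k.
Proof. by move=> /(gap_ge i); exact: lt_le_trans. Qed.

Lemma gap_sqr i k : gap i k * gap i k = shift i k * shift i k.
Proof. by rewrite -expr2 real_normK ?num_real. Qed.

Lemma half_lt3 a : (a < 6)%N -> (a./2 < 3)%N.
Proof. by case: a => [|[|[|[|[|[|]]]]]]. Qed.

Lemma uphalf_lt6 a : (a < 6)%N -> (uphalf a < 6)%N.
Proof. by case: a => [|[|[|[|[|[|]]]]]]. Qed.

(** The coefficient of the translation term has absolute value 1 and [E / gap] is at most [1] in
    absolute value, so the slab does not thicken as the gap grows. *)
Lemma level_slab i a x : (a < 6)%N -> B i x ->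
  `|level i a x - (slab i a./2)%:R * slab_height| <= C + 1.
Proof.
move=> a6 Bx; have g0 := gap_gt0 i (half_lt3 a6); have gL := gap_ge i (half_lt3 a6).
have -> : level i a x - (slab i a./2)%:R * slab_height =
    shift i a./2 / gap i a./2 * X i (uphalf a) x 0 0 + E i a x / gap i a./2.
  by rewrite /level; ring.
apply: le_trans (ler_normD _ _) _.
rewrite !normrM normfV normr_id divff ?gt_eqF // mul1r.
apply: lerD.
  apply: le_trans (coord_le_norm _ _) _.
  exact: periscope_bound (per i) _ _ (uphalf_lt6 a6) Bx.
rewrite -/(gap i a./2) ler_pdivrMr // mul1r.
apply: le_trans (periscope_height_bound (per i) a6 Bx) _.
by apply: le_trans gL; rewrite /L; move: C0; lra.
Qed.

(** In the squared length of [track_gap] the term [shift^2] cancels against [gap^2]; what remains is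
    the squared displacement of [X], matched by [periscope_gap], and a cross term, matched by the
    translation term of the level. *)
Lemma leg_rise_level i k x : (k < 3)%N ->
  level i k.*2.+1 x - level i k.*2 x = leg_rise (track_gap i k x) (gap i k).
Proof.
move=> k3; have g0 := gap_gt0 i k3; have G := gap_sqr i k.
have := periscope_gap (per i) k x.
rewrite /level /= uphalf_double doubleK /leg_rise /sq_norm /half_sq.
rewrite /track_gap /track !mxE /= addr0 => Eg.
have -> : (slab i k)%:R * slab_height + E i k.*2.+1 x / gap i k +
   shift i k / gap i k * X i k.+1 x 0 0 -
   ((slab i k)%:R * slab_height + E i k.*2 x / gap i k +
    shift i k / gap i k * X i k x 0 0) =
   (E i k.*2.+1 x - E i k.*2 x) / gap i k +
   shift i k / gap i k * (X i k.+1 x 0 0 - X i k x 0 0) by ring.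
rewrite Eg G /shift; field; by rewrite gt_eqF.
Qed.

Lemma smooth_level i a : smooth_on (B i) (level i a).
Proof.
have sE := periscope_smooth (per i) a.
have sX := periscope_smooth_map (per i) (uphalf a) 0.
apply: smoothD => //; last by apply: smoothM => //; exact: smooth_cst.
apply: smoothD => //; first exact: smooth_cst.
by apply: smoothM => //; exact: smooth_cst.
Qed.

Lemma potential_level i a : (a < 6)%N ->
  potential (B i) (level i a) (X i (uphalf a))
    (fun x => (gap i a./2)^-1 *: track_gap i a./2 x).
Proof.
move=> a6 x Bx w; have oBi : open (B i) by exact: oB.
have g0 : gap i a./2 != 0 by rewrite gt_eqF // gap_gt0 // half_lt3.
have sE := periscope_smooth (per i) a.
have sX j := periscope_smooth_map (per i) (uphalf a) j.
have pot := periscope_derive (per i) a6 Bx w.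
set g := gap i a./2 in g0 *; set s := shift i a./2.
have lE : level i a = fun x => (slab i a./2)%:R * slab_height +
  (g^-1 * E i a x + s / g * X i (uphalf a) x 0 0).
  by apply/funext => y; rewrite /level -addrA [E i a y / _]mulrC.
have dE := smooth_diff sE Bx; have dX j := smooth_diff (sX j) Bx.
have sgE : smooth_on (B i) (fun x => g^-1 * E i a x).
  by apply: smoothM => //; exact: smooth_cst.
have sgX : smooth_on (B i) (fun x => s / g * X i (uphalf a) x 0 0).
  by apply: smoothM => //; exact: smooth_cst.
rewrite lE derive_add; last 2 first.
- exact: differentiable_cst.
- exact: smooth_diff (smoothD oBi sgE sgX) Bx.
rewrite derive_cst add0r (derive_add w (smooth_diff sgE Bx) (smooth_diff sgX Bx)).
rewrite (derive_scale _ w dE) (derive_scale _ w (dX 0)) pot.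
rewrite /track_gap /track !mxE /= addr0 /s /shift; ring.
Qed.

(** In different slots the bounded parts [X] would have to differ by at least the slot width, which
    exceeds [2 * C]. *)
Lemma track_slot i j k l x y : (k < 6)%N -> (l < 6)%N -> B i x -> B j y ->
  track i k x = track j l y -> slot i k = slot j l /\ X i k x = X j l y.
Proof.
move=> k6 l6 Bx By eq_t.
have S : slot i k = slot j l.
  have bx := le_trans (coord_le_norm _ 0) (periscope_bound (per i) k6 Bx).
  have by_ := le_trans (coord_le_norm _ 0) (periscope_bound (per j) l6 By).
  have : track i k x 0 0 = track j l y 0 0 by rewrite eq_t.
  rewrite /track ![(_ + row2 _ _) _ _]mxE !row2_0 /offset => eq0.
  apply/eqP; rewrite -(eqr_nat R) -subr_eq0 -normr_eq0; apply/negPn/negP.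
  move=> ne; have n1 : 1 <= `|(slot i k)%:R - (slot j l)%:R : R|.
    have -> : (slot i k)%:R - (slot j l)%:R = ((slot i k)%:Z - (slot j l)%:Z)%:~R :> R.
      by rewrite rmorphB.
    rewrite -intr_norm -[1]/(1%:~R) ler_int -gtz0_ge1 normr_gt0.
    apply: contraNneq ne => /eqP; rewrite subr_eq0 => /eqP[->].
    by rewrite subrr normr0.
  have : L * `|(slot i k)%:R - (slot j l)%:R : R| = `|X j l y 0 0 - X i k x 0 0|.
    rewrite -(gtr0_norm L0) -normrM mulrBr.
    congr (`|_|); move: eq0; lra.
  have := ler_normB (X j l y 0 0) (X i k x 0 0).
  have : L <= L * `|(slot i k)%:R - (slot j l)%:R : R| by rewrite ler_peMr // ltW.
  rewrite /L; move: C0; lra.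
split=> //; move: eq_t; rewrite /track /offset S; exact: addIr.
Qed.

Lemma X_inj i k x y : B i x -> B i y -> X i k x = X i k y -> x = y.
Proof.
have [Y [_ _ YX]] := periscope_embedding (per i) k.
by move=> Bx By eX; rewrite -(YX _ Bx) eX YX.
Qed.

Lemma slab_lt i j k l : (slab i k < slab j l)%N ->
  (slab i k)%:R * slab_height + slab_height <= (slab j l)%:R * slab_height.
Proof.
move=> lt; rewrite -{2}[slab_height]mul1r -mulrDl ler_wpM2r //.
  by rewrite /slab_height; move: C0; lra.
by rewrite natr1 ler_nat.
Qed.

Lemma level_lt i j a b x y : (a < 6)%N -> (b < 6)%N -> B i x -> B j y ->
  (slab i a./2 < slab j b./2)%N -> level i a x < level j b y.
Proof.
move=> a6 b6 Bx By /slab_lt.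
have := level_slab a6 Bx; have := level_slab b6 By.
rewrite !ler_norml => /andP[h1 h2] /andP[h3 h4]; rewrite /slab_height in h1 h2 h3 h4 *.
by move: C0; lra.
Qed.

Lemma slab_inj i j k l : slab i k = slab j l -> i = j /\ k = l.
Proof.
move=> eq_s.
have N0 : (0 < N)%N by apply: leq_ltn_trans (ltn_ord i).
have e : i = j :> nat.
  have := congr1 (modn^~ N) eq_s; rewrite /slab !modnMDl !modn_small //.
split; first exact: val_inj.
have := congr1 (divn^~ N) eq_s.
by rewrite /slab !divnMDl // !divn_small // !addn0.
Qed.

(** The two equations isolate the change of [E]: it is [mu] times [|d|^2 / 2 - c^2], where [d] is
    the untranslated displacement. Its size is at least [|mu| (c^2 - 4 C^2)], but the Lipschitz
    bound allows only [|mu| C (2 C + c)]; for large [c] this leaves [mu = 0]. *)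
Lemma self_hit i a x y (mu : R) : (a < 6)%N -> B i x -> B i y ->
  X i (uphalf a) y - X i (uphalf a) x = mu *: track_gap i a./2 x ->
  level i a y - level i a x = mu * leg_rise (track_gap i a./2 x) (gap i a./2) ->
  mu = 0.
Proof.
move=> a6 Bx By eqX eql; apply/eqP; rewrite -normr_le0 leNgt; apply/negP => mu0.
set k := a./2 in eqX eql; have k3 : (k < 3)%N := half_lt3 a6.
have g0 := gap_gt0 i k3; have gL := gap_ge i k3; have G := gap_sqr i k.
have k6 : (k < 6)%N by apply: ltn_trans k3 _.
have k16 : (k.+1 < 6)%N by apply: leq_ltn_trans k3 _.
have b0 := periscope_bound (per i) k6 Bx.
have b1 := periscope_bound (per i) k16 Bx.
have lip := periscope_lipschitz (per i) a6 By Bx.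
rewrite eqX normrZ in lip.
set c := gap i k in g0 gL G eql.
pose d j := X i k.+1 x 0 j - X i k x 0 j.
have db j : `|d j| <= 2 * C.
  apply: le_trans (ler_normB _ _) _.
  by have := le_trans (coord_le_norm _ j) b0; have := le_trans (coord_le_norm _ j) b1; lra.
have D0 : track_gap i k x 0 0 = d 0 + shift i k.
  by rewrite /track_gap /track !mxE /= /d /shift; ring.
have D1 : track_gap i k x 0 1 = d 1.
  by rewrite /track_gap /track !mxE /= /d; ring.
have DN : `|track_gap i k x| <= 2 * C + c.
  apply: norm_le_coord; first by move: C0; lra.
  apply: forall_ord2; rewrite ?D0 ?D1.
    by apply: le_trans (ler_normD _ _) _; rewrite lerD.
  by apply: le_trans (db 1) _; lra.
have eqX0 : X i (uphalf a) y 0 0 - X i (uphalf a) x 0 0 = mu * track_gap i k x 0 0.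
  by have := congr1 (fun z : V => z 0 0) eqX; rewrite !mxE.
have EE : E i a y - E i a x = mu * ((d 0 ^+ 2 + d 1 ^+ 2) / 2 - c * c).
  have c0 : c != 0 by rewrite gt_eqF.
  have e1 : (E i a y - E i a x) / c + shift i k / c * (mu * (d 0 + shift i k)) =
      mu * (((d 0 + shift i k) * (d 0 + shift i k) + d 1 * d 1 - c * c) / (2 * c)).
    move: eql; rewrite /leg_rise /sq_norm D0 D1 -D0 -eqX0 /level -/k -/c => <-; ring.
  have e2 : E i a y - E i a x = c * ((E i a y - E i a x) / c).
    by rewrite mulrC divfK.
  have e3 : (E i a y - E i a x) / c =
      mu * (((d 0 + shift i k) * (d 0 + shift i k) + d 1 * d 1 - c * c) / (2 * c)) -
      shift i k / c * (mu * (d 0 + shift i k)) by rewrite -e1 addrK.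
  rewrite e2 e3.
  have -> : c * (mu * (((d 0 + shift i k) * (d 0 + shift i k) + d 1 * d 1 - c * c) / (2 * c)) -
      shift i k / c * (mu * (d 0 + shift i k))) =
      mu * ((d 0 ^+ 2 + d 1 ^+ 2) / 2 - c * c / 2 - shift i k * shift i k / 2) by field.
  by rewrite -G; congr (_ * _); field.
have q (j : 'I_2) : d j ^+ 2 <= (2 * C) ^+ 2.
  by rewrite -[leLHS]real_normK ?num_real // ler_sqr ?nnegrE // mulr_ge0.
have low : c * c - 4 * C ^+ 2 <= `|(d 0 ^+ 2 + d 1 ^+ 2) / 2 - c * c|.
  rewrite -normrN; apply: le_trans (ler_norm _).
  have := q 0; have := q 1; rewrite exprMn; lra.
have up : `|(d 0 ^+ 2 + d 1 ^+ 2) / 2 - c * c| <= C * (2 * C + c).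
  rewrite -(ler_pM2l mu0) -normrM -EE; apply: le_trans lip _.
  by rewrite mulrCA ler_pM2l // ler_wpM2l.
have h1 : 0 <= c * (c - 4 * (C + 1)) by rewrite mulr_ge0 ?subr_ge0 // ltW.
have h2 : 0 <= C * (c - 4 * (C + 1)) by rewrite mulr_ge0 ?subr_ge0.
have h3 : 0 <= C ^+ 2 by rewrite sqr_ge0.
move: (le_trans low up) h1 h2 h3 g0 C0; rewrite expr2; lra.
Qed.

Lemma half_eq b k : b./2 = k -> b = k.*2 \/ b = k.*2.+1.
Proof. by move=> <-; have := odd_double_half b; lia. Qed.

Lemma uphalf_eq b k : uphalf b = k -> b = k.*2.-1 \/ (b = k.*2 /\ (0 < k)%N).
Proof. by move=> <-; have := odd_double_half b; rewrite uphalf_half; lia. Qed.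

Lemma double_lt6 k : (k < 3)%N -> (k.*2 < 6)%N /\ (k.*2.+1 < 6)%N.
Proof. by case: k => [|[|[|]]]. Qed.

Lemma slabs_apart (u a1 a2 : R) : `|u - a1| <= C + 1 -> `|u - a2| <= C + 1 ->
  a1 + slab_height <= a2 -> False.
Proof.
rewrite /slab_height !ler_norml => /andP[h1 h2] /andP[h3 h4] h5.
by move: h1 h2 h3 h4 h5 C0; lra.
Qed.

Lemma offset_sub (a b d o : V) : a + o + d = b + o -> b - a = d.
Proof. by rewrite addrAC => /addIr <-; rewrite addrAC subrr add0r. Qed.

Lemma line_reverse (a d : V) (m : R) : a + m *: d = a + d + (m - 1) *: d.
Proof. by apply/rowP => i; rewrite !mxE; ring. Qed.

(** * The path of one ray and the mirrors that it meets *)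

Section Beam.
Variables (i : 'I_N) (x : V).
Hypothesis Pix : P i x.

Let Bx : B i x. Proof. exact: PB. Qed.

Definition duration (m : nat) : R :=
  if odd m then leg_length (track_gap i m./2 x) (gap i m./2)
  else level i m x - level i m.-1 x.

Definition direction (m : nat) : 'rV[R]_3 :=
  if odd m then leg_velocity (track_gap i m./2 x) (gap i m./2) else upward.

(** The incoming ray is at height [s] at time [s], so the first hit occurs at the time
    [level i 0 x]. *)
Fixpoint hit_time (a : nat) : R :=
  if a is a'.+1 then hit_time a' + duration a else level i 0 x.

Local Notation t := hit_time.
Local Notation v := direction.
Local Notation p := (vertex x i).

Lemma point3D (y z : V) (a b : R) : point3 y a + point3 z b = point3 (y + z) (a + b).
Proof.
by apply/rowP; apply: forall_ord3; rewrite mxE ?point3_0 ?point3_1 ?point3_2 ?mxE.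
Qed.

Lemma point3Z (z : V) (a b : R) : a *: point3 z b = point3 (a *: z) (a * b).
Proof.
by apply/rowP; apply: forall_ord3; rewrite mxE ?point3_0 ?point3_1 ?point3_2 ?mxE.
Qed.

Lemma point3_inj (y z : V) (a b : R) : point3 y a = point3 z b -> y = z /\ a = b.
Proof.
move=> e; split; first by rewrite -(hor_point3 y a) e hor_point3.
by rewrite -(point3_2 y a) e point3_2.
Qed.

Lemma point3_upward (y : V) (a b : R) : point3 y a + b *: upward = point3 y (a + b).
Proof. by rewrite /upward point3Z point3D scaler0 addr0 mulr1. Qed.

Lemma even_or_odd a : exists k, a = k.*2 \/ a = k.*2.+1.
Proof.
exists a./2; case o : (odd a); [right|left]; by rewrite -{1}(odd_double_half a) o.
Qed.

Lemma duration_gt0 m : (0 < m)%N -> (m < 6)%N -> 0 < duration m.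
Proof.
move=> m0 m6; rewrite /duration; case: ifPn => om.
  by apply: leg_length_gt0; apply: gap_gt0; exact: half_lt3.
rewrite subr_gt0; apply: level_lt => //.
  by apply: leq_ltn_trans m6; exact: leq_pred.
have iN := ltn_ord i.
by rewrite /slab; case: m m0 m6 om => [|[|[|[|[|[|]]]]]] //= _ _ _; lia.
Qed.

Lemma hit_time_incr a : (a.+1 < 6)%N -> t a < t a.+1.
Proof. by move=> a6; rewrite /= ltrDl; exact: duration_gt0. Qed.

Lemma vertex_step a : (a.+1 < 6)%N -> p a.+1 = p a + (t a.+1 - t a) *: v a.+1.
Proof.
move=> a6; have -> : t a.+1 - t a = duration a.+1 by rewrite /= addrC addKr.
rewrite /duration /direction.
have [k [ak|ak]] := even_or_odd a; rewrite ak /= odd_double /= in a6 *.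
  have k3 : (k < 3)%N by move: a6; lia.
  rewrite uphalf_double (leg_lengthK (track_gap i k x) (gap_gt0 i k3)) /vertex.
  rewrite point3D -(leg_rise_level _ _ k3) /= uphalf_double doubleK; congr point3.
    by rewrite /track_gap addrC subrK.
  by rewrite addrC subrK.
by rewrite /vertex point3_upward /= uphalf_double doubleK [level _ _ x + _]addrC subrK.
Qed.

Lemma unit_direction m : (m <= 6)%N -> dot (v m) (v m) = 1.
Proof.
move=> m6; rewrite /direction; case: ifPn => om; last exact: dot_upward.
apply: dot_leg_velocity; apply: gap_gt0.
by case: m m6 om => [|[|[|[|[|[|[|]]]]]]].
Qed.

(** Inner slots determine segment and beam by parity. Slot [0] is shared by the incoming and
    outgoing segments; there the slabs tell the first stage from the last, while the beam stays
    undetermined. *)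
Lemma slot_inj (j : 'I_N) k b : (k <= 3)%N -> (b < 6)%N ->
  slot i k = slot j (uphalf b) ->
  ((0 < k)%N -> (slab i k.-1 <= slab j b./2)%N) ->
  ((k < 3)%N -> (slab j b./2 <= slab i k)%N) ->
  uphalf b = k /\ (i = j :> nat \/ k = 0%N \/ k = 3).
Proof.
rewrite /slab; have := ltn_ord i; have := ltn_ord j.
case: k => [|[|[|[|//]]]] jN iN _; case: b => [|[|[|[|[|[|//]]]]]] _ /= e h1 h2;
  (try have {}h1 := h1 isT); (try have {}h2 := h2 isT); lia.
Qed.

(** The track is constant on a vertical segment, so a mirror met there has the same slot. In an
    inner slot the beam is the same and [X] is injective on its piece. In slot [0] the map is [id]
    or [F], so injectivity of [f] gives the same starting point, and disjointness of the pieces the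
    same beam. *)
Lemma even_leg_hit (j : 'I_N) y k b s : (k <= 3)%N -> (b < 6)%N -> P j y ->
  ((0 < k)%N -> t k.*2.-1 <= s) -> ((k < 3)%N -> s <= t k.*2) ->
  leg_line t v p k.*2 s = vertex y j b -> [/\ i = j, y = x & s = t b].
Proof.
move=> k3 b6 Pjy s1 s2; have By := PB Pjy.
have vk : v k.*2 = upward by rewrite /direction odd_double.
have uk : uphalf k.*2.-1 = k by case: (k) => //= k'; rewrite doubleK.
rewrite /leg_line vk /vertex point3_upward uk => /point3_inj[eqt eql].
have k6 : (k < 6)%N by apply: leq_ltn_trans k3 _.
have [eqs eqX] := track_slot k6 (uphalf_lt6 b6) Bx By eqt.
have tE : (0 < k)%N -> t k.*2 = t k.*2.-1 + (level i k.*2 x - level i k.*2.-1 x).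
  by case: (k) => // k' _; rewrite doubleS /= /duration /= negbK odd_double.
(* Heights on the segment lie between the levels of its end mirrors, which confines the slab of the
   mirror met. *)
have H1 : (0 < k)%N -> (slab i k.-1 <= slab j b./2)%N.
  move=> k0; have := s1 k0; rewrite leqNgt => s1'; apply/negP => lt.
  have kE : k.*2.-1./2 = k.-1 by case: (k) => //= k'; rewrite uphalf_double.
  have k26 : (k.*2.-1 < 6)%N by move: k3 k0; lia.
  have := level_lt b6 k26 By Bx; rewrite kE => /(_ lt).
  by rewrite -eql ltNge lerDl subr_ge0 s1'.
have H2 : (k < 3)%N -> (slab j b./2 <= slab i k)%N.
  move=> k3'; have := s2 k3'; rewrite leqNgt => s2'; apply/negP => lt.
  have [k26 _] := double_lt6 k3'.
  have := level_lt k26 b6 Bx By; rewrite doubleK => /(_ lt).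
  rewrite -eql; move: s2'; case: (posnP k) => [->/=|k0]; first by lra.
  rewrite (tE k0); lra.
have [bk ijk] := slot_inj k3 b6 eqs H1 H2.
have [eij eyx] : i = j /\ y = x.
  case: ijk => [/val_inj ij|ijk].
    split=> //; have By' : B i y by rewrite ij.
    by apply/esym; apply: (X_inj (k := k) Bx By'); rewrite eqX bk ij.
  have yx : x = y.
    move: eqX; rewrite bk; case: ijk => ->.
      by rewrite !(periscope_first (per _)).
    rewrite !(periscope_last (per _)) !Ff //; exact: f_inj Pix Pjy.
  by split=> //; apply: (P_disj Pix); rewrite yx.
split=> //; move: eql; rewrite -eij eyx => eql.
have [bE|[bE k0]] := uphalf_eq bk.
  by move: eql; rewrite bE => eql; apply/eqP; rewrite -subr_eq0; apply/eqP; lra.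
move: eql; rewrite bE (tE k0); lra.
Qed.

(** By convexity a diagonal leg stays in the slab of its own stage and beam, which leaves only its
    two end mirrors; [self_hit] is applied with [mu] from the near end and with [mu - 1] from the
    far end. *)
Lemma odd_leg_hit (j : 'I_N) y k b s : (k < 3)%N -> (b < 6)%N -> P j y ->
  t k.*2 <= s -> s <= t k.*2.+1 ->
  leg_line t v p k.*2.+1 s = vertex y j b -> [/\ i = j, y = x & s = t b].
Proof.
move=> k3 b6 Pjy s1 s2; have By := PB Pjy.
have g0 := gap_gt0 i k3.
set D := track_gap i k x; set l := leg_length D (gap i k).
have l0 : 0 < l by exact: leg_length_gt0.
have vk : v k.*2.+1 = l^-1 *: point3 D (leg_rise D (gap i k)).
  by rewrite /direction /= odd_double /= uphalf_double.
have tE : t k.*2.+1 = t k.*2 + l by rewrite /= /duration /= odd_double /= uphalf_double.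
pose mu := (s - t k.*2) / l.
have mu0 : 0 <= mu by rewrite divr_ge0 ?subr_ge0 // ltW.
have mu1 : mu <= 1 by rewrite ler_pdivrMr // mul1r lerBlDl -tE.
rewrite /leg_line vk scalerA -/mu point3Z /vertex point3D /= uphalf_double.
move=> /point3_inj[eqt eql].
have [k26 k216] := double_lt6 k3.
have rise := leg_rise_level i x k3; rewrite -/D in rise.
have Sk : `|level i k.*2 x + mu * leg_rise D (gap i k) - (slab i k)%:R * slab_height| <= C + 1.
  have := level_slab k26 Bx; have := level_slab k216 Bx.
  rewrite /= uphalf_double doubleK -rise => h1 h2.
  have -> : level i k.*2 x + mu * (level i k.*2.+1 x - level i k.*2 x) -
      (slab i k)%:R * slab_height =
      (1 - mu) * (level i k.*2 x - (slab i k)%:R * slab_height) +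
      mu * (level i k.*2.+1 x - (slab i k)%:R * slab_height) by ring.
  apply: le_trans (ler_normD _ _) _; rewrite (normrM (1 - mu)) (normrM mu) (ger0_norm mu0).
  rewrite (ger0_norm (_ : 0 <= 1 - mu)) ?subr_ge0 //.
  have -> : C + 1 = (1 - mu) * (C + 1) + mu * (C + 1) by ring.
  by rewrite lerD // ler_wpM2l // subr_ge0.
have Sb := level_slab b6 By; rewrite eql in Sk.
have eq_slab : slab j b./2 = slab i k.
  have [lt|lt|//] := ltngtP (slab j b./2) (slab i k).
    by case: (slabs_apart Sb Sk (slab_lt lt)).
  by case: (slabs_apart Sk Sb (slab_lt lt)).
have [eij bk] := slab_inj eq_slab.
rewrite eij in By eqt eql *.
have [bE|bE] := half_eq bk.
- rewrite bE uphalf_double in eqt eql.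
  have m0 : mu = 0.
    apply: (self_hit k26 Bx By); rewrite ?uphalf_double ?doubleK -/D.
      exact: offset_sub eqt.
    by rewrite -eql addrC addKr.
  split=> //; last first.
    by apply/eqP; rewrite bE -subr_eq0; move/eqP: m0; rewrite mulf_eq0 invr_eq0 (gt_eqF l0) orbF.
  apply/esym/(X_inj (k := k) Bx By); move: eqt; rewrite m0 scale0r addr0; exact: addIr.
rewrite bE /= doubleK in eqt eql.
have eqt' : track i k.+1 y = track i k.+1 x + (mu - 1) *: D.
  have T1 : track i k.+1 x = track i k x + D by rewrite /D /track_gap addrC subrK.
  by rewrite -eqt T1 line_reverse.
have m0 : mu - 1 = 0.
  apply: (self_hit k216 Bx By); rewrite /= ?uphalf_double ?doubleK -/D.
    exact: offset_sub (esym eqt').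
  by rewrite -eql -rise; ring.
split=> //.
  apply/esym/(X_inj (k := k.+1) Bx By); move: eqt'; rewrite m0 scale0r addr0 => /esym; exact: addIr.
have : mu = 1 by move: m0; lra.
rewrite bE tE /mu => /(congr1 ( *%R^~ l)); rewrite divfK ?gt_eqF // mul1r => <-.
by rewrite addrC subrK.
Qed.

Lemma leg_hit (j : 'I_N) y m b s : (m <= 6)%N -> (b < 6)%N -> P j y ->
  leg (fun a : 'I_6 => t a) m s -> leg_line t v p m s = vertex y j b ->
  [/\ i = j, y = x & s = t b].
Proof.
move=> m6 b6 Pjy [H1 H2].
have lo a : (a < 6)%N -> (a < m)%N -> t a <= s.
  by move=> a6 am; exact: (H1 (Ordinal a6)).
have hi a : (a < 6)%N -> (m <= a)%N -> s <= t a.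
  by move=> a6 ma; exact: (H2 (Ordinal a6)).
have [k [mk|mk]] := even_or_odd m; rewrite mk in m6 lo hi *.
  apply: even_leg_hit => //; first by move: m6; lia.
    by move=> k0; apply: lo; move: m6 k0; lia.
  by move=> k3; apply: hi => //; move: k3; lia.
apply: odd_leg_hit => //; first by move: m6; lia.
  by apply: lo; move: m6; lia.
by apply: hi => //; move: m6; lia.
Qed.

End Beam.


Lemma smooth_surface_beam i a : smooth_surface (graph_surface (B i)
  (X i (uphalf a)) (row2 (offset i (uphalf a)) 0) (level i a)).
Proof.
have [Y eXY] := periscope_embedding (per i) (uphalf a).
exact: smooth_surface_graph eXY (@smooth_level i a).
Qed.

Lemma beam_mirror_sub i a :
  graph_surface (P i) (X i (uphalf a)) (row2 (offset i (uphalf a)) 0) (level i a) `<=`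
  graph_surface (B i) (X i (uphalf a)) (row2 (offset i (uphalf a)) 0) (level i a).
Proof. by move=> _ [x Px <-]; exists x => //; exact: PB. Qed.

(** [P i] need not be open, so the surface that determines the normals is taken over the open set
    [B i]. *)
Definition beam_mirror i a : mirror R :=
  Mirror (@smooth_surface_beam i a) (@beam_mirror_sub i a).

Definition beam_mirrors (m : 'I_#|{: 'I_N * 'I_6}|) : mirror R :=
  beam_mirror (enum_val m).1 (enum_val m).2.

Lemma beam_normal i a x : P i x -> (a < 6)%N -> exists nu,
  [/\ normal_vector (mirror_surface (beam_mirror i a)) (vertex x i a) nu,
      dot (direction i x a) nu != 0 &
      direction i x a.+1 = reflect_velocity nu (direction i x a)].
Proof.
move=> Px a6; have Bx := PB Px; have g0 := gap_gt0 i (half_lt3 a6).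
exists (mirror_normal (track_gap i a./2 x) (gap i a./2)).
have [Y eXY] := periscope_embedding (per i) (uphalf a).
split.
- have sX : smooth_map (B i) (X i (uphalf a)).
    by move=> j; exact: periscope_smooth_map (per i) _ _.
  exact: (normal_vector_graph _ sX eXY (@smooth_level i a) (@potential_level i a a6) Bx).
- rewrite /direction; case: ifPn => _; first exact: dot_leg_velocity_normal.
  exact: dot_upward_normal.
rewrite /direction /= uphalf_half; case: (odd a) => /=.
  by rewrite reflect_leg_velocity.
by rewrite add0n reflect_upward.
Qed.

Theorem beam_realized i x : P i x ->
  exists (t : 'I_6 -> R) (v : nat -> 'rV[R]_3) (gam : R -> 'rV[R]_3),
    [/\ billiard_motion beam_mirrors t v gam,
        \forall s \near -oo%R, gam s = point3 x s &
        exists tau : R, \forall s \near +oo%R, gam s = point3 (f x) (s - tau)].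
Proof.
move=> Px; set t := hit_time i x; set v := direction i x; set p := vertex x i.
have t_incr a : (a.+1 < 6)%N -> t a < t a.+1 by exact: hit_time_incr.
have p_step a : (a.+1 < 6)%N -> p a.+1 = p a + (t a.+1 - t a) *: v a.+1.
  exact: vertex_step.
exists (fun j => t j), v, (polygon 6 t v p).
have hit m j s : (j <= 6)%N -> leg (fun a : 'I_6 => t a) j s ->
    mirror_set (beam_mirrors m) (leg_line t v p j s) ->
    (enum_val m).1 = i /\ s = t (enum_val m).2.
  move=> j6 ls [y Py yE].
  have [ij _ st] := leg_hit Px j6 (ltn_ord (enum_val m).2) Py ls (esym yE).
  by split; [rewrite ij|].
split.
- apply: polygon_motion => //.
  + by move=> m; exact: unit_direction.
  + move=> j s m j6 ls /(hit _ _ _ j6 ls)[_ ->].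
    by exists (enum_val m).2.
  + move=> j j6; exists (enum_rank (i, Ordinal j6)).
    by rewrite /beam_mirrors enum_rankK /=; exists x.
  move=> j m j6 Mp.
  have lt := leg_time t_incr j6.
  rewrite -(leg_line_end p_step j6) in Mp.
  have [mi tE] := hit _ _ _ (ltnW j6) lt Mp.
  have jE : j = (enum_val m).2 :> nat.
    have m6 := ltn_ord (enum_val m).2.
    have [lt1|lt1|//] := ltngtP j (enum_val m).2.
      by have := time_lt t_incr lt1 m6; rewrite tE ltxx.
    by have := time_lt t_incr lt1 j6; rewrite tE ltxx.
  rewrite /beam_mirrors mi -jE; exact: beam_normal.
- have H : \forall s \near -oo%R, s <= t 0 by apply: nbhs_ninfty_le; exact: num_real.
  apply: filterS H => s s0.
  have l0 : leg (fun j : 'I_6 => t j) 0 s.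
    split=> // j _; apply: le_trans s0 _.
    case: (posnP j) => [->//|j0]; apply: ltW; exact: (time_lt t_incr).
  rewrite (polygon_leg t_incr p_step _ l0) // /leg_line /= /v /direction /p /vertex.
  rewrite /= point3_upward /track /offset /= mulr0 (periscope_first (per i)) /t /=.
  congr point3; first by apply: row2P; rewrite !mxE /= addr0.
  by rewrite addrC subrK.
(* The delay is the time of the last reflection minus the height at which it happens. *)
exists (t 5 - level i 5 x).
have H : \forall s \near +oo%R, t 5 <= s by apply: nbhs_pinfty_ge; exact: num_real.
apply: filterS H => s s5.
have l6 : leg (fun j : 'I_6 => t j) 6 s.
  split=> j j6; last by have := ltn_ord j; rewrite ltnNge j6.
  apply: le_trans s5; have : (j <= 5)%N by rewrite -ltnS.
  by rewrite leq_eqVlt => /predU1P[->//|j5]; apply: ltW; exact: (time_lt t_incr).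
rewrite (polygon_leg t_incr p_step _ l6) // /leg_line /= /v /direction /p /vertex.
rewrite /= point3_upward /track /offset /= mulr0 (periscope_last (per i)) (Ff Px).
congr point3; first by apply: row2P; rewrite !mxE /= addr0.
by rewrite opprB addrCA addrA.
Qed.

End Configuration.

(** * Passage to compact domains *)

Section Jacobian.
Context {R : realType}.
Local Notation V := 'rV[R]_2.
Implicit Types (U W D : set V) (F G f : V -> V).

Lemma smooth_map_on U F : open U -> smooth_on U F -> smooth_map U F.
Proof. by move=> oU sF i; exact: smooth_row. Qed.

Lemma smooth_map_continuous U F x : smooth_map U F -> U x -> {for x, continuous F}.
Proof.
move=> sF Ux; apply: differentiable_continuous; apply: differentiable_rV => i.
exact: smooth_diff (sF i) Ux.
Qed.

Lemma det_mx2 (A : 'M[R]_2) : \det A = A 0 0 * A 1 1 - A 0 1 * A 1 0.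
Proof.
rewrite (expand_det_row A 0) sum_ord2 /cofactor !det_mx11 !mxE /=.
have -> : lift 0 0 = 1 :> 'I_2 by exact: val_inj.
have -> : lift 1 0 = 0 :> 'I_2 by exact: val_inj.
by rewrite expr0 mul1r expr1 mulN1r mulrN.
Qed.

Lemma det_jacobian f F x : differentiable F x -> (\forall y \near x, f y = F y) ->
  \det ('J f x) = jac F x.
Proof.
move=> dF nfF; have nFf : \forall y \near x, F y = f y.
  by apply: filterS nfF => y ->.
have df : differentiable f x by exact: near_eq_differentiable nFf dF.
have Jij i j : 'J f x i j = pd i j F x.
  rewrite /jacobian mxE /= -deriveE // (near_eq_derive _ nfF) derive_rV //.
by rewrite det_mx2 !Jij /jac; ring.
Qed.

Lemma jac_near_id f x : (\forall y \near x, f y = y) -> jac f x = 1.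
Proof.
move=> nf; have pdE i j : pd i j f x = ('e_i : V) 0 j.
  rewrite -(derive_coord x); apply: near_eq_derive.
  by apply: filterS nf => y ->.
by rewrite /jac !pdE !mxE !eqxx /= mulr1 mulr0 subr0.
Qed.

Lemma continuous_closure (h : V -> R) W x (c e : R) : {for x, continuous h} ->
  closure W x -> 0 < e -> exists2 y, W y & `|h x - h y| < e.
Proof.
move=> /cvgrPdist_lt ch cW e0.
by have [y [Wy /= Hy]] := cW _ (ch _ e0); exists y.
Qed.

(** On [W] the identity [G \o F = id] gives Jacobians with product [1]. At a boundary point the
    identity may fail on every neighbourhood, but the product is continuous there and still nonzero;
    then positivity on [W] passes to the limit. *)
Lemma jac_gt0_closure U F W x : open U -> smooth_map U F -> open W -> W `<=` U ->
  U x -> closure W x -> (forall y, W y -> 0 < jac F y) ->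
  (exists U' G, [/\ open U', smooth_map U' G, U' (F x) &
     forall y, W y -> U' (F y) /\ G (F y) = y]) -> 0 < jac F x.
Proof.
move=> oU sF oW WU Ux cWx Jpos [U' [G [oU' sG U'x GF]]].
have cJ := smooth_continuous (smooth_jac oU sF) Ux.
have J0 : jac F x != 0.
  apply/eqP => J0.
  have cJG := smooth_continuous (smooth_jac oU' sG) U'x.
  have ch : {for x, continuous (fun y => jac G (F y) * jac F y)}.
    apply: continuousM => //.
    by apply: continuous_comp; [exact: smooth_map_continuous Ux|exact: cJG].
  have [y Wy] := continuous_closure 0 ch cWx ltr01.
  have [U'y GFy] := GF _ Wy.
  have <- : jac (G \o F) y = jac G (F y) * jac F y.
    exact: jac_comp sF sG (WU _ Wy) U'y.
  rewrite J0 mulr0 sub0r normrN jac_near_id ?normr1 ?ltxx //.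
  by apply: filterS (open_nbhs_nbhs (conj oW Wy)) => z /GF[].
rewrite lt_neqAle eq_sym J0 /= leNgt; apply/negP => Jneg.
have e0 : 0 < - jac F x by rewrite oppr_gt0.
have [y Wy] := continuous_closure 0 cJ cWx e0.
have := Jpos _ Wy => Jy; rewrite ltr_norml => /andP[h1 h2]; lra.
Qed.

Lemma bounded_closure_compact W : bounded_set W -> compact (closure W).
Proof.
move=> [M [Mr HM]]; apply: bounded_closed_compact; last exact: closed_closure.
have M1 : M < M + 1 by rewrite ltrDl.
have sub : closure W `<=` closed_ball_ Num.norm (0 : V) (M + 1).
  have cB : closed (closed_ball_ Num.norm (0 : V) (M + 1)) by exact: closed_closed_ball_.
  move/closure_id : cB => ->.
  apply: closureS => x Wx.
  by rewrite /closed_ball_ /= sub0r normrN; exact: (HM _ M1 _ Wx).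
exists (M + 1); split; first exact: num_real.
move=> M' hM x /sub; rewrite /closed_ball_ /= sub0r normrN => /le_trans; apply.
exact: ltW.
Qed.

Lemma periscope_le B F X E (C C' : R) : C <= C' -> periscope B F X E C ->
  periscope B F X E C'.
Proof.
move=> CC [h1 h2 h3 h4 h5 h6 h7 h8 h9 h10]; split=> //.
- by move=> k x k6 Bx; exact: le_trans (h8 _ _ k6 Bx) _.
- by move=> k x k6 Bx; exact: le_trans (h9 _ _ k6 Bx) _.
- move=> a x y a6 Bx By; apply: le_trans (h10 _ _ _ a6 Bx By) _.
  exact: ler_wpM2r.
Qed.

Lemma finite_realization D f F : compact D -> (forall x, D x -> f x = F x) ->
  (forall x y, D x -> D y -> f x = f y -> x = y) ->
  (forall x, D x -> exists r X E C,
     [/\ 0 < r, 0 <= C & periscope (ball x r) F X E C]) ->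
  exists (N : nat) (M : 'I_N -> mirror R), realized_by M 6 D f.
Proof.
move=> cD fF finj loc.
have /choice[d Hd] : forall x, exists e : R * (nat -> V -> V) * (nat -> V -> R) * R,
    D x -> [/\ 0 < e.1.1.1, 0 <= e.2 & periscope (ball x e.1.1.1) F e.1.1.2 e.1.2 e.2].
  move=> x; have [Dx|nDx] := pselect (D x).
    by have [r [X [E [C H]]]] := loc x Dx; exists (r, X, E, C).
  by exists (0, (fun _ => id), (fun _ _ => 0), 0).
have : cover_compact D by rewrite -compact_cover.
move=> /(_ _ D (fun x => ball x (d x).1.1.1)) [].
- by move=> x Dx; apply: ball_open; case: (Hd _ Dx).
- by move=> x Dx; exists x => //; apply: ballxx; case: (Hd _ Dx).
move=> D' D'D cov.
pose N := size (finmap.enum_fset D'); pose pt (i : 'I_N) : V := nth 0 (finmap.enum_fset D') i.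
have Dpt i : D (pt i) by apply/set_mem/D'D; exact: mem_nth.
pose B i := ball (pt i) (d (pt i)).1.1.1.
(* Each point goes to the first ball that contains it, so the pieces are disjoint and still cover
   [D]. *)
pose P (i : 'I_N) : set V :=
  [set x | [/\ D x, B i x & forall j : 'I_N, (j < i)%N -> ~ B j x]].
pose C := \sum_i (d (pt i)).2.
have C0 : 0 <= C by apply: sumr_ge0 => i _; case: (Hd _ (Dpt i)).
have oB i : open (B i) by apply: ball_open; case: (Hd _ (Dpt i)).
have PB i : P i `<=` B i by move=> x [].
have per i : periscope (B i) F (d (pt i)).1.1.2 (d (pt i)).1.2 C.
  have [_ _] := Hd _ (Dpt i); apply: periscope_le.
  by rewrite /C (bigD1 i) //= lerDl sumr_ge0 // => j _; case: (Hd _ (Dpt j)).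
have P_disj i j x : P i x -> P j x -> i = j.
  move=> [_ Bi Hi] [_ Bj Hj]; apply: val_inj.
  by have [/Hj|/Hi|//] := ltngtP (i : nat) j.
have fFP i x : P i x -> F x = f x by move=> [Dx _ _]; rewrite fF.
have finjP i j x y : P i x -> P j y -> f x = f y -> x = y.
  by move=> [Dx _ _] [Dy _ _]; exact: finj.
exists _, (beam_mirrors oB PB per) => x Dx.
have [i Pix] : exists i, P i x.
  have [y /= yD' Byx] := cov _ Dx.
  have iN : (index y (finmap.enum_fset D') < N)%N by rewrite index_mem.
  pose i0 := Ordinal iN.
  have Bi0 : B i0 x by rewrite /B /pt /= nth_index.
  have i0P : `[< B i0 x >] by apply/asboolP.
  case: (@arg_minnP _ i0 (fun i => `[< B i x >]) val i0P) => i /asboolP Bi imin.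
  exists i; split=> // j ji /asboolP/imin; by rewrite leqNgt ji.
exact: (beam_realized C0 oB PB per P_disj fFP finjP Pix).
Qed.

End Jacobian.

Theorem corollary2 (R : realType) (D1 D2 : set 'rV[R]_2)
    (f : 'rV[R]_2 -> 'rV[R]_2)
    (hD1 : compact_domain D1) (hD2 : compact_domain D2)
    (hf : diffeomorphism D1 D2 f) (hor : orientation_preserving D1 f) :
  exists (N : nat) (M : 'I_N -> mirror R), realized_by M 6 D1 f.
Proof.
have [W [[oW _ _] bW D1E]] := hD1.
have [[fD finj _] [U [F [oU D1U smF fF]]] [g [[U' [G [oU' D2U' smG gG]]] gf]]] := hf.
have sF := smooth_map_on oU smF; have sG := smooth_map_on oU' smG.
have WD1 : W `<=` D1 by rewrite D1E; exact: subset_closure.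
have WU : W `<=` U by move=> x /WD1/D1U.
have fF_near x : W x -> \forall y \near x, f y = F y.
  move=> Wx; apply: filterS (open_nbhs_nbhs (conj oW Wx)) => y /WD1; exact: fF.
have U'F x : D1 x -> U' (F x) by move=> Dx; rewrite -fF //; exact/D2U'/fD.
(* The hypothesis on [f] gives positivity on the open set [W]; the smooth inverse [G] carries it to
   the closure. *)
have Jpos x : D1 x -> 0 < jac F x.
  move=> Dx; apply: (jac_gt0_closure oU sF oW WU (D1U _ Dx)).
  - by rewrite -D1E.
  - move=> y Wy; rewrite -(det_jacobian (smF [::] _ (WU _ Wy)) (fF_near _ Wy)).
    by apply: hor; apply: filterS (open_nbhs_nbhs (conj oW Wy)).
  exists U', G; split=> //; first exact: U'F.
  move=> y /WD1 Dy; split; first exact: U'F.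
  by rewrite -fF // -gG; [exact: gf|exact: fD].
apply: (@finite_realization _ D1 f F) => //.
- by rewrite D1E; exact: bounded_closure_compact.
- by move=> x y Dx Dy; apply: finj; rewrite inE.
move=> x Dx.
have [r [X [E [C [r0 _ C0 per]]]]] := local_periscope oU sF (D1U _ Dx) (Jpos _ Dx).
by exists r, X, E, C.
Qed.
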